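(* Let $(a,b)$ be a bounded open interval with $0\in[a,b]$, let $q\in L^1(a,b)$ and $L=\frac{d^2}{dx^2}-q$. Suppose $\{\varphi_k\}_{k\in\mathbb{N}_0}$ is a standard $L$-base and suppose $T:L^1(a,b)\to L^1(a,b)$ is a bounded linear operator such that $T[x^k]=\varphi_k$ for all $k\in\mathbb{N}_0$. Then $T$ is a standard transmutation operator on $W^{2,1}(a,b)$ corresponding to $L$; in particular $Tu\in W^{2,1}(a,b)$ and $\left(\frac{d^2}{dx^2}-q\right)Tu=T\frac{d^2}{dx^2}u$ for every $u\in W^{2,1}(a,b)$.
   Context: All functions are complex valued; $\mathbb{N}_0=\{0,1,2,\dots\}$. Elements of $W^{1,1}(a,b)$ are identified with their absolutely continuous representatives on $[a,b]$, elements of $W^{2,1}(a,b)$ with their $C^1[a,b]$ representatives. $L=\frac{d^2}{dx^2}-q$ has domain $D_L=W^{2,1}(a,b)$. A linear map $T$ with domain $D_T$ is a transmutation operator (corresponding to $L$) on $\chi\subseteq D_L$ if for every $u\in\chi$ (with $T$ defined on $u$) we have $u''\in D_T$, $Tu\in D_L$ and $\left(\frac{d^2}{dx^2}-q\right)Tu=Tu''$. An $L$-base is a system $\{\varphi_k\}_{k\in\mathbb{N}_0}$ with $\varphi_k''-q\varphi_k=0$ for $k=0,1$ and $\varphi_k''-q\varphi_k=k(k-1)\varphi_{k-2}$ for $k\ge2$, in the sense of weak solutions, i.e. $\varphi_k\in W^{1,1}(a,b)$ and the equation holds in the sense of distributions (equivalently $\varphi_k\in W^{2,1}(a,b)$ and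 the equation holds a.e.). A standard $L$-base (s-$L$-base) is an $L$-base with $\varphi_k(0)=\varphi_k'(0)=0$ for all $k\ge2$. A transmutation operator $T$ on a set containing all polynomials is called standard (an s-transmutation) if $\{T[x^k]\}_{k\in\mathbb{N}_0}$ is an s-$L$-base. *)

(* Defs.v *)
From HB Require Import structures.
From mathcomp Require Import all_boot all_order all_algebra.
From mathcomp Require Import all_classical all_reals all_analysis.
From mathcomp Require Import complex.
Import Order.TTheory GRing.Theory Num.Theory.
Import numFieldNormedType.Exports.

Set Implicit Arguments.
Unset Strict Implicit.
Unset Printing Implicit Defensive.

Local Open Scope classical_set_scope.
Local Open Scope ring_scope.
Local Open Scope complex_scope.

(* Elements of L^1(a, b) are handled through their representatives
   R -> R[i]: equality in L^1(a, b) is [aeeq], values outside ]a, b[ are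
   irrelevant. Being an element of a Sobolev space, a weak derivative, a weak
   solution or a (standard) L-base is invariant under [aeeq] among functions
   that are Borel on ]a, b[. *)
Section Defs.
Variables (R : realType) (a b : R).
Implicit Types (u v f g q : R -> R[i]).

Notation mu := (@lebesgue_measure R).

Definition aeeq u v : Prop := {ae mu, forall x : R, x \in `]a, b[ -> u x = v x}.

Definition L1 u : Prop :=
  mu.-integrable `]a, b[ (EFin \o (fun x => complex.Re (u x))) /\
  mu.-integrable `]a, b[ (EFin \o (fun x => complex.Im (u x))).

Definition cintegral u : R[i] :=
  (\int[mu]_(x in `]a, b[) complex.Re (u x))%R
  +i* (\int[mu]_(x in `]a, b[) complex.Im (u x))%R.

(* [`|z|] is the modulus as an element of R[i]; its real part is the modulus
   as an element of R. *)
Definition L1norm u : R := (\int[mu]_(x in `]a, b[) complex.Re `|u x|)%R.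

(* Real-valued test functions suffice to test complex-valued functions. The
   support is closed and bounded, hence compact. *)
Definition test_function (psi : R -> R) : Prop :=
  (forall n x, derivable (derive1n n psi) x 1) /\
  closure [set x | psi x != 0] `<=` `]a, b[.

Definition weak_derivative (n : nat) u v : Prop :=
  forall psi : R -> R, test_function psi ->
    cintegral (fun x => u x * (derive1n n psi x)%:C) =
    (-1) ^+ n * cintegral (fun x => v x * (psi x)%:C).

(* The Sobolev space W^{m,1}(a, b). *)
Definition sobolev (m : nat) : set (R -> R[i]) :=
  [set u | L1 u /\
    forall n, (n <= m)%N -> exists v, L1 v /\ weak_derivative n u v].

(* A chosen representative of the n-th weak derivative (unique up to [aeeq]);
   the zero function when u has no n-th weak derivative in L^1(a, b). *)
Definition wderiv (n : nat) u : R -> R[i] :=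
  xget (fun=> 0) [set v | L1 v /\ weak_derivative n u v].

Definition Lop q u : R -> R[i] := fun x => wderiv 2 u x - q x * u x.

(* Linear maps with domain D, up to [aeeq]; the second clause says that T is
   well defined on classes. *)
Definition linear_map (D : set (R -> R[i])) (T : (R -> R[i]) -> R -> R[i])
    : Prop :=
  [/\ D (fun=> 0),
      forall u v, D u -> D v -> aeeq u v -> aeeq (T u) (T v) &
      forall (c : R[i]) u v, D u -> D v ->
        D (fun x => c * u x + v x) /\
        aeeq (T (fun x => c * u x + v x)) (fun x => c * T u x + T v x)].

Definition bounded_linear_L1 (T : (R -> R[i]) -> R -> R[i]) : Prop :=
  [/\ linear_map L1 T,
      forall u, L1 u -> L1 (T u) &
      exists M : R, forall u, L1 u -> L1norm (T u) <= M * L1norm u].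

(* v, with derivative v1, is the C^1[a, b] representative of u: v1 is the
   derivative of v on ]a, b[ and both are continuous up to the endpoints (so
   that v1 a and v1 b are the one-sided derivatives). *)
Definition C1_real (f f1 : R -> R) : Prop :=
  [/\ {within `[a, b], continuous f}, {within `[a, b], continuous f1} &
      forall x, x \in `]a, b[ -> is_derive x 1 f (f1 x)].

Definition C1_representative u v v1 : Prop :=
  [/\ aeeq u v,
      C1_real (fun x => complex.Re (v x)) (fun x => complex.Re (v1 x)) &
      C1_real (fun x => complex.Im (v x)) (fun x => complex.Im (v1 x))].

(* u'' - q u = f in the sense of distributions, with u in W^{1,1}(a, b). *)
Definition weak_solution q u f : Prop :=
  sobolev 1 u /\
  forall psi : R -> R, test_function psi ->
    cintegral (fun x => u x * (derive1n 2 psi x)%:C - q x * u x * (psi x)%:C) =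
    cintegral (fun x => f x * (psi x)%:C).

Definition L_base q (phi : nat -> R -> R[i]) : Prop :=
  [/\ weak_solution q (phi 0%N) (fun=> 0),
      weak_solution q (phi 1%N) (fun=> 0) &
      forall k, (2 <= k)%N ->
        weak_solution q (phi k)
          (fun x => (k * (k - 1))%:R * phi (k - 2)%N x)].

Definition standard_L_base q (phi : nat -> R -> R[i]) : Prop :=
  L_base q phi /\
  forall k, (2 <= k)%N ->
    exists v v1, [/\ C1_representative (phi k) v v1, v 0 = 0 & v1 0 = 0].

Definition monomial (k : nat) : R -> R[i] := fun x => (x ^+ k)%:C.

Definition transmutation q (D : set (R -> R[i]))
    (T : (R -> R[i]) -> R -> R[i]) (chi : set (R -> R[i])) : Prop :=
  [/\ linear_map D T, chi `<=` sobolev 2 &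
      forall u, chi u ->
        [/\ D u, D (wderiv 2 u), sobolev 2 (T u) &
            aeeq (Lop q (T u)) (T (wderiv 2 u))]].

Definition standard_transmutation q (D : set (R -> R[i]))
    (T : (R -> R[i]) -> R -> R[i]) (chi : set (R -> R[i])) : Prop :=
  [/\ transmutation q D T chi,
      forall p : {poly R[i]}, chi (fun x => p.[x%:C]) &
      standard_L_base q (fun k => T (monomial k))].

End Defs.

(* Main.v *)
Require Import Defs.
From mathcomp Require Import all_boot all_order all_algebra.
From mathcomp Require Import all_classical all_reals all_analysis.
From mathcomp Require Import measurable_realfun complex ring lra.
Import Order.TTheory GRing.Theory Num.Theory.
Import numFieldNormedType.Exports.

(** If [p] is a polynomial, [(T p)'' - q (T p) = T p''] holds by linearity: for
    the monomials it is the definition of an L-base. The point of the theorem is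
    the passage to the limit. Approximating [u''] in L^1 by polynomials yields
    [T p_n -> T u] and [T p_n'' -> T u''] in L^1, but [q] is merely integrable,
    so that nothing follows for the products [q (T p_n)]. The standard
    normalisation gives the missing uniform convergence.

    Write [K w] for the twofold primitive of [w] from 0 ([cprim (cprim w)]
    below). By Taylor's formula every [u] in W^{2,1} is [c0 + c1 x + K u'']
    ([sobolev_taylor]). The images of [1] and [x] under [T] solve the homogeneous
    equation, and it remains to treat [K w] with [w] in L^1. If [w = r] is a
    polynomial, [g = T (K r)] is a combination of the [phi_k] with [k >= 2]; as
    these have zero Cauchy data at 0 ([C1_initial]), [g] solves the Volterra
    equation [g = K (q g + T r)] ([solution_T_cpoly]). Gronwall's inequality then
    bounds the supremum of [|g|] by a constant times the L^1 norm of [T r]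
    ([gronwall], [solution_bound]), hence of [r]. Applied to differences, this
    shows that for polynomials [r_n] tending to [w] in L^1 the functions
    [T (K r_n)] converge uniformly. Their limit [l] satisfies
    [l = K (q l + T w)], and it is [T (K w)] because [T] is bounded
    ([solution_T]). Reading this equation backwards, [T (K w)] belongs to
    W^{2,1}, with second derivative [q T (K w) + T w] ([solution_sobolev]).

    The functional analysis underneath rests on two facts. The polynomials are
    dense in L^1 ([poly_dense]); therefore identities such as the one saying that
    [f] is the weak derivative of its primitive ([has_wderiv_prim]) need only be
    checked on polynomials. And a function with zero weak derivative is constant
    ([has_wderiv0_const]), which provides Taylor's formula, the uniqueness of
    weak derivatives being the fundamental lemma of the calculus of variations
    ([aeeqr0_test]). A real valued test function sees real and imaginary parts
    separately, so that all of this is proved for real functions. *)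

Set Implicit Arguments.
Unset Strict Implicit.
Unset Printing Implicit Defensive.

Local Open Scope classical_set_scope.
Local Open Scope ring_scope.

(** * Integrable real functions on a bounded interval *)
Section Real.
Context {R : realType} (a b : R).
Implicit Types f g h : R -> R.
Notation mu := (@lebesgue_measure R).

Definition integ f := mu.-integrable `]a, b[ (EFin \o f).
Definition Int f := \int[mu]_(x in `]a, b[) f x.

Lemma measurable_oo : measurable (`]a, b[ : set (measurableTypeR R)).
Proof. exact: measurable_itv. Qed.

Lemma mu_oo_lty : (mu `]a, b[ < +oo)%E.
Proof. by rewrite lebesgue_measure_itv/=; case: ifP => _; rewrite ?ltry// -EFinB ltry. Qed.

Lemma integ_measurable f : integ f -> measurable_fun `]a, b[ f.
Proof. by move=> /integrableP[/measurable_EFinP]. Qed.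

Lemma eq_integ f g : (forall x, x \in `]a, b[ -> f x = g x) -> integ f -> integ g.
Proof.
move=> fg; apply: eq_integrable; first exact: measurable_oo.
by move=> x; rewrite inE/= => xD; rewrite /= fg.
Qed.

Lemma eq_Int f g : (forall x, x \in `]a, b[ -> f x = g x) -> Int f = Int g.
Proof. by move=> fg; apply: eq_Rintegral => x; rewrite inE/= => /fg. Qed.

Lemma integD f g : integ f -> integ g -> integ (fun x => f x + g x).
Proof. by move=> hf hg; have := integrableD measurable_oo hf hg. Qed.

Lemma integB f g : integ f -> integ g -> integ (fun x => f x - g x).
Proof. by move=> hf hg; have := integrableB measurable_oo hf hg. Qed.

Lemma integZ c f : integ f -> integ (fun x => c * f x).
Proof. by move=> hf; have := integrableZl measurable_oo c hf. Qed.

Lemma integN f : integ f -> integ (fun x => - f x).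
Proof. by move=> /(integZ (-1)); apply: eq_integ => x _; rewrite mulN1r. Qed.

Lemma integ_norm f : integ f -> integ (fun x => `|f x|).
Proof. by move=> hf; have := integrable_abse hf. Qed.

Lemma integ_le f g : measurable_fun `]a, b[ f ->
  (forall x, x \in `]a, b[ -> `|f x| <= g x) -> integ g -> integ f.
Proof.
move=> mf fg; apply: le_integrable; first exact: measurable_oo.
  exact/measurable_EFinP.
by move=> x xD /=; rewrite lee_fin (le_trans (fg _ xD))// ler_norm.
Qed.

Lemma integ_bounded f (M : R) : measurable_fun `]a, b[ f ->
  (forall x, x \in `]a, b[ -> `|f x| <= M) -> integ f.
Proof.
move=> mf fM; apply: measurable_bounded_integrable; first exact: measurable_oo.
- exact: mu_oo_lty.
- exact: mf.
- exists M; split; first by rewrite num_real.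
  by move=> x Mx y yD /=; rewrite (le_trans (fM _ yD))// ltW.
Qed.

Lemma integ_cst (c : R) : integ (fun=> c).
Proof. by apply: (@integ_bounded _ `|c|). Qed.

Lemma integ_mul f h (M : R) : integ f -> measurable_fun `]a, b[ h ->
  (forall x, x \in `]a, b[ -> `|h x| <= M) -> integ (fun x => h x * f x).
Proof.
move=> hf mh hM; apply: (@integ_le _ (fun x => M * `|f x|)).
- by apply: measurable_funM => //; exact: integ_measurable.
- by move=> x xD; rewrite normrM ler_wpM2r// hM.
- exact/integZ/integ_norm.
Qed.

Lemma IntD f g : integ f -> integ g -> Int (fun x => f x + g x) = Int f + Int g.
Proof. by move=> hf hg; rewrite /Int RintegralD//; exact: measurable_oo. Qed.

Lemma IntB f g : integ f -> integ g -> Int (fun x => f x - g x) = Int f - Int g.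
Proof. by move=> hf hg; rewrite /Int RintegralB//; exact: measurable_oo. Qed.

Lemma IntZ c f : integ f -> Int (fun x => c * f x) = c * Int f.
Proof. by move=> hf; rewrite /Int RintegralZl//; exact: measurable_oo. Qed.

Lemma Int_ge0 f : (forall x, x \in `]a, b[ -> 0 <= f x) -> 0 <= Int f.
Proof. by move=> f0; apply: Rintegral_ge0. Qed.

Lemma Int_le f g : integ f -> integ g ->
  (forall x, x \in `]a, b[ -> f x <= g x) -> Int f <= Int g.
Proof. by move=> hf hg fg; apply: le_Rintegral => //; exact: measurable_oo. Qed.

Lemma Int_norm f : integ f -> `|Int f| <= Int (fun x => `|f x|).
Proof. by move=> hf; apply: le_normr_Rintegral => //; exact: measurable_oo. Qed.

Lemma Int_cst (c : R) : a <= b -> Int (fun=> c) = c * (b - a).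
Proof.
move=> ab; rewrite /Int Rintegral_cst; last exact: measurable_oo.
rewrite [X in fine X]lebesgue_measure_itv/= lte_fin; case: ltP => //= ba.
by rewrite (_ : b = a) ?subrr//; apply/le_anti; rewrite ab ba.
Qed.

Definition aeeqr f g : Prop :=
  {ae mu, forall x : R, x \in `]a, b[ -> f x = g x}.

Lemma ae_and (P Q : R -> Prop) :
  {ae mu, forall x, P x} -> {ae mu, forall x, Q x} -> {ae mu, forall x, P x /\ Q x}.
Proof.
move=> hP hQ; have F := ae_filter_ringOfSetsType mu.
exact: (filterI hP hQ).
Qed.

Lemma ae_sub (P Q : R -> Prop) :
  (forall x, P x -> Q x) -> {ae mu, forall x, P x} -> {ae mu, forall x, Q x}.
Proof.
move=> PQ hP; have F := ae_filter_ringOfSetsType mu.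
exact: (filterS PQ hP).
Qed.

Lemma ae_all (P : R -> Prop) : (forall x, P x) -> {ae mu, forall x, P x}.
Proof. by move=> hP; apply/aeW. Qed.

Lemma Int_ae f g : measurable_fun `]a, b[ f -> measurable_fun `]a, b[ g ->
  aeeqr f g -> Int f = Int g.
Proof.
move=> mf mg fg; rewrite /Int /Rintegral; congr fine.
apply: ae_eq_integral; [exact: measurable_oo|exact/measurable_EFinP|exact/measurable_EFinP|].
by apply: ae_sub fg => x /= fg xD; rewrite fg.
Qed.

Lemma Int_norm_eq0 f : integ f -> Int (fun x => `|f x|) = 0 -> aeeqr f (fun=> 0).
Proof.
move=> hf h0; have mf := integ_measurable hf.
have /(ae_eq_integral_abs mu measurable_oo) [+ _] : measurable_fun `]a, b[ (EFin \o f).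
  exact/measurable_EFinP.
have -> : (\int[mu]_(x in `]a, b[) `|(EFin \o f) x|)%E = 0%E.
  have := integ_norm hf => /(integrable_fin_num measurable_oo) /fineK <-.
  by congr EFin.
by move=> /(_ erefl); apply: ae_sub => x /= h xD; case: (h xD).
Qed.

(** Turns an almost everywhere statement into a point to work at: an interval
    of positive length is not negligible. *)
Lemma ae_point (P : R -> Prop) (c d : R) : c < d ->
  {ae mu, forall x, P x} -> exists2 x, c < x < d & P x.
Proof.
move=> cd hP; apply: contrapT => hn.
have : mu.-negligible (`]c, d[ : set R).
  apply: negligibleS hP => x /= xcd Px; apply: hn; exists x => //.
have mcd : measurable (`]c, d[ : set (measurableTypeR R)) by exact: measurable_itv.
move=> /(negligibleP mu mcd).
rewrite [X in X = _]lebesgue_measure_itv /= lte_fin cd => /eqP.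
by rewrite -EFinB eqe subr_eq0 gt_eqF.
Qed.

End Real.

(** * Density of the polynomials in L^1 *)
Section Bernstein.
Context {R : realType}.
Implicit Types (t : R) (f g : nat -> R).

(** The Bernstein sum of [f 0, ..., f n] at [t], that is the expectation of
    [f] at the number of successes in [n] trials of probability [t]. Conditioning
    on the first trial gives a recursion in which every property below is an
    induction that never meets a binomial coefficient. *)
Fixpoint bernstein t n f : R :=
  if n is n'.+1 then t * bernstein t n' (f \o S) + (1 - t) * bernstein t n' f else f 0%N.

Lemma bernsteinD t n f g : bernstein t n (fun k => f k + g k) = bernstein t n f + bernstein t n g.
Proof. by elim: n f g => [//|n IH] f g /=; rewrite !IH; ring. Qed.

Lemma bernsteinZ t n c f : bernstein t n (fun k => c * f k) = c * bernstein t n f.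
Proof. by elim: n f => [//|n IH] f /=; rewrite !IH; ring. Qed.

Lemma bernstein_cst t n c : bernstein t n (fun=> c) = c.
Proof. by elim: n => [//|n IH] /=; rewrite IH; ring. Qed.

Lemma bernstein_le t n f g : 0 <= t <= 1 ->
  (forall k, (k <= n)%N -> f k <= g k) -> bernstein t n f <= bernstein t n g.
Proof.
move=> /andP[t0 t1]; elim: n f g => [|n IH] f g fg /=; first exact: fg.
rewrite lerD// ler_wpM2l ?subr_ge0// IH// => k kn; first exact: fg.
by apply: fg; rewrite (leq_trans kn).
Qed.

(** The second moment about an arbitrary centre [- c], as the recursion shifts
    the centre; at the mean, [c = - n t], it is the variance [n t (1 - t)]. *)
Lemma bernstein_sq t n c : bernstein t n (fun k => (k%:R + c) ^+ 2) =
  n%:R * t * (1 - t) + (n%:R * t + c) ^+ 2.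
Proof.
elim: n c => [|n IH] c /=; first by ring.
rewrite IH (_ : (_ \o S) = fun k => (k%:R + (1 + c)) ^+ 2) ?IH -?natr1; last first.
  by apply/funext => k /=; rewrite -natr1; ring.
by ring.
Qed.

Lemma bernstein_norm t n f y : 0 <= t <= 1 ->
  `|bernstein t n f - y| <= bernstein t n (fun k => `|f k - y|).
Proof.
move=> t01; rewrite ler_norml; apply/andP; split.
  rewrite -[X in X <= _]mulN1r -bernsteinZ -[in leRHS](bernstein_cst t n y) -[in leRHS]mulN1r.
  rewrite -[in leRHS]bernsteinZ -bernsteinD; apply: bernstein_le => // k _.
  by rewrite !mulN1r lerNl -normrN ler_norm.
rewrite -[in leLHS](bernstein_cst t n y) -[in leLHS]mulN1r -[in leLHS]bernsteinZ -bernsteinD.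
by apply: bernstein_le => // k _; rewrite mulN1r ler_norm.
Qed.

Lemma bernstein_poly (u v : R) n f :
  exists p : {poly R}, forall x, p.[x] = bernstein (u * x + v) n f.
Proof.
elim: n f => [|n IH] f; first by exists (f 0%N)%:P => x; rewrite hornerC.
have [p hp] := IH (f \o S); have [q hq] := IH f.
exists ((u *: 'X + v%:P) * p + (1 - (u *: 'X + v%:P)) * q) => x.
by rewrite !hornerE /= hp hq.
Qed.

(** Bernstein's argument: near [x] the values of [g] are close to [g x] by
    continuity; away from [x] their difference, at most [2 M], is absorbed by a
    multiple of the squared distance, whose mean is of order [1 / n]. *)
Lemma bernstein_cvg (a b : R) (g : R -> R) (M x : R) : x \in `]a, b[ ->
  {for x, continuous g} -> (forall y, a <= y <= b -> `|g y| <= M) ->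
  bernstein ((x - a) / (b - a)) n (fun k => g (a + (b - a) * (k%:R / n%:R)))
    @[n --> \oo] --> g x.
Proof.
rewrite in_itv/= => /andP[ax xb] cg gM.
have ab : 0 < b - a by rewrite subr_gt0 (lt_trans ax).
have M0 : 0 <= M by rewrite (le_trans _ (gM x _))// !ltW.
set t := (x - a) / (b - a).
have t01 : 0 <= t <= 1.
  by rewrite /t divr_ge0 ?ler_pdivrMr ?mul1r ?lerD2r ?subr_ge0 ?(ltW ax) ?(ltW xb) ?ltW// -subr_gt0.
apply/cvgrPdist_le => e e0.
have e2 : 0 < e / 2 by rewrite divr_gt0.
have /cvgrPdist_lt/(_ _ e2) := cg => -[d /= d0 hd].
have near_bd y : a <= y <= b -> `|g y - g x| <= e / 2 + (M + M) / d ^+ 2 * (y - x) ^+ 2.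
  move=> yab; have [yd|yd] := ltP `|x - y| d.
    have := hd _ yd; rewrite /= distrC => /ltW /le_trans; apply; rewrite lerDl.
    by rewrite mulr_ge0 ?sqr_ge0// divr_ge0 ?addr_ge0// sqr_ge0.
  rewrite (le_trans (ler_normB _ _))// (le_trans (lerD (gM _ yab) (gM x _)))//; first by rewrite !ltW.
  have h1 : M + M <= (M + M) / d ^+ 2 * (y - x) ^+ 2.
    rewrite mulrAC -mulrA ler_peMr ?addr_ge0// ler_pdivlMr ?exprn_gt0// mul1r.
    rewrite -(real_normK (num_real (y - x))) distrC.
    by apply: lerXn2r; rewrite ?nnegrE ?normr_ge0// ltW.
  by rewrite (le_trans h1)// lerDr ltW.
have [N HN] : exists N : nat, forall n, (N < n)%N ->
    (M + M) / d ^+ 2 * (b - a) ^+ 2 / n%:R <= e / 2.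
  set K := (M + M) / d ^+ 2 * (b - a) ^+ 2.
  have K0 : 0 <= K by rewrite mulr_ge0 ?sqr_ge0// divr_ge0 ?addr_ge0// sqr_ge0.
  exists (Num.truncn (K / (e / 2))) => n nN; have n0 : 0 < n%:R :> R by rewrite ltr0n (leq_ltn_trans _ nN).
  rewrite ler_pdivrMr// mulrC -ler_pdivrMr//.
  rewrite ltW// (lt_le_trans (truncnS_gt _))// ler_nat//.
exists N.+1 => // n /= nN; have n0 : 0 < n%:R :> R by rewrite ltr0n (leq_ltn_trans _ nN).
rewrite distrC (le_trans (bernstein_norm _ _ _ t01))//.
pose y k := a + (b - a) * (k%:R / n%:R).
apply: (@le_trans _ _ (bernstein t n (fun k => e / 2 +
   (M + M) / d ^+ 2 * (b - a) ^+ 2 / n%:R ^+ 2 * (k%:R + - (n%:R * t)) ^+ 2))).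
  apply: bernstein_le => // k kn.
  have yk : a <= y k <= b.
    rewrite /y lerDl -lerBrDl mulr_ge0 ?divr_ge0 ?ler0n ?(ltW ab)//=.
    by rewrite ger_pMr// ler_pdivrMr// mul1r ler_nat.
  apply: (le_trans (near_bd _ yk)); rewrite lerD2l.
  have -> : y k - x = (b - a) / n%:R * (k%:R + - (n%:R * t)).
    by rewrite /y /t; field; rewrite (gt_eqF n0) (gt_eqF ab).
  by rewrite le_eqVlt; apply/orP; left; apply/eqP; field; rewrite (gt_eqF n0) (gt_eqF d0).
rewrite bernsteinD bernstein_cst bernsteinZ bernstein_sq subrr expr0n addr0.
rewrite [leRHS]splitr lerD2l (le_trans _ (HN _ nN))//.
set K := (M + M) / d ^+ 2 * (b - a) ^+ 2.
have K0 : 0 <= K by rewrite mulr_ge0 ?sqr_ge0// divr_ge0 ?addr_ge0// sqr_ge0.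
rewrite [leLHS](_ : _ = K / n%:R * (t * (1 - t))); last by field; rewrite (gt_eqF n0).
have [t0 t1] := andP t01; apply: ler_piMr; last by nra.
by rewrite divr_ge0// ltW.
Qed.

End Bernstein.

Section Density.
Context {R : realType} (a b : R) (ab : a < b).
Implicit Types f g h : R -> R.

Lemma measurable_continuous f : continuous f -> measurable_fun `]a, b[ f.
Proof.
move=> cf; apply: measurable_funTS; exact: continuous_measurable_fun.
Qed.

(** Bernstein sums are bounded by the supremum of [g] on [[a, b]], so that
    pointwise convergence is enough by dominated convergence. *)
Lemma poly_dense_continuous g (e : R) : continuous g -> 0 < e ->
  exists p : {poly R}, Int a b (fun x => `|g x - p.[x]|) <= e.
Proof.
move=> cg e0.
have [M gM] : exists M, forall y, a <= y <= b -> `|g y| <= M.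
  have cgab : {within `[a, b], continuous g} by exact: continuous_subspaceT.
  have /compact_bounded[M [_ hM]] := continuous_compact cgab (@segment_compact _ a b).
  exists (M + 1) => y yab; apply: (hM (M + 1)); first by rewrite ltrDl.
  by exists y => //=; rewrite in_itv/=.
pose B n x := bernstein ((x - a) / (b - a)) n (fun k => g (a + (b - a) * (k%:R / n%:R))).
have BP n : exists p : {poly R}, forall x, p.[x] = B n x.
  have [p hp] := bernstein_poly (b - a)^-1 (- a / (b - a)) n
    (fun k => g (a + (b - a) * (k%:R / n%:R))).
  by exists p => x; rewrite hp /B; congr bernstein; ring.
have cB n : measurable_fun `]a, b[ (B n).
  have [p hp] := BP n; rewrite (_ : B n = horner p); last by apply/funext => x; rewrite hp.
  by apply: measurable_continuous => x; exact: continuous_horner.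
have mg : measurable_fun `]a, b[ g by exact: measurable_continuous.
have Bbd n x : (0 < n)%N -> x \in `]a, b[ -> `|B n x| <= M.
  move=> n0; rewrite in_itv/= => /andP[ax xb]; rewrite -[B n x]subr0.
  have b0 : 0 < b - a by rewrite subr_gt0.
  have t01 : 0 <= (x - a) / (b - a) <= 1.
    apply/andP; split; first by rewrite divr_ge0 ?subr_ge0// ltW.
    by rewrite ler_pdivrMr// mul1r lerD2r ltW.
  rewrite (le_trans (bernstein_norm _ _ _ t01))// -[leRHS](bernstein_cst ((x - a) / (b - a)) n).
  apply: bernstein_le => // k kn; rewrite subr0 gM//.
  rewrite lerDl -lerBrDl mulr_ge0 ?divr_ge0 ?ler0n ?(ltW b0)//=.
  by rewrite ger_pMr// ler_pdivrMr ?ltr0n// mul1r ler_nat.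
pose f_ n x := (`|g x - B n.+1 x|)%:E.
have [] := @dominated_convergence _ _ _ (@lebesgue_measure R) `]a, b[ (measurable_oo a b) f_ (cst 0%E)
   (cst (M + M)%:E).
- move=> n; apply/measurable_EFinP; apply: measurableT_comp => //.
  by apply: measurable_funB; [exact: mg|exact: cB].
- exact: measurable_cst.
- apply: ae_all => x xD.
  have /cvgrPdist_lt cB' := @bernstein_cvg R a b g M x xD (cg x) gM.
  apply/fine_cvgP; split; first by near=> n.
  apply/cvgrPdist_lt => d d0; have [N _ hN] := cB' d d0.
  exists N => // n /= nN; rewrite sub0r normrN normr_id; apply: hN => /=.
  exact: leq_trans nN _.
- exact: (@integ_cst R a b (M + M)).
- apply: ae_all => x n xD; rewrite /f_ /= lee_fin normr_id.
  rewrite (le_trans (ler_normB _ _))// lerD ?Bbd// gM//.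
  by move: xD; rewrite /= in_itv/= => /andP[/ltW -> /ltW ->].
move=> _ _; rewrite integral0 => /fine_cvgP[_ /cvgrPdist_lt/(_ _ e0)[N _ hN]].
have [p hp] := BP N.+1; exists p.
have := hN N (leqnn _); rewrite /= sub0r normrN => /ltW /(le_trans _); apply.
rewrite (le_trans _ (ler_norm _))// le_eqVlt; apply/orP; left; apply/eqP.
by apply: eq_Int => x _; rewrite hp.
Unshelve. all: by end_near. Qed.

Lemma poly_dense f (e : R) : integ a b f -> 0 < e ->
  exists p : {poly R}, Int a b (fun x => `|f x - p.[x]|) <= e.
Proof.
move=> hf e0.
have [g_ [cg ig]] := approximation_continuous_integrable (measurable_oo a b) (mu_oo_lty a b) hf.
have e2 : 0 < e / 2 by rewrite divr_gt0.
move=> /fine_cvgP[_ /cvgrPdist_lt/(_ _ e2)[N _ hN]].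
have [p hp] := poly_dense_continuous (cg N) e2; exists p.
have cp : integ a b (fun x => p.[x]).
  have : {within `[a, b], continuous (horner p)}.
    by apply: continuous_subspaceT => x; exact: continuous_horner.
  move=> /(continuous_compact_integrable (@segment_compact _ a b)).
  by apply: integrableS => //; exact: subset_itv_oo_cc.
apply: (@le_trans _ _ (Int a b (fun x => `|f x - g_ N x| + `|g_ N x - p.[x]|))).
  apply: Int_le; first exact/integ_norm/integB.
    by apply: integD; apply/integ_norm/integB => //; exact: ig.
  move=> x _; rewrite (le_trans _ (ler_normD _ _))//.
  by rewrite addrA subrK.
rewrite IntD; [|by apply/integ_norm/integB => //; exact: ig..].
rewrite [leRHS]splitr lerD//.
have := hN N (leqnn _); rewrite /= sub0r normrN => /ltW /(le_trans _); apply.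
exact: ler_norm.
Qed.

End Density.

(** * The primitive vanishing at 0 *)
Section Primitive.
Context {R : realType} (a b : R).
Implicit Types f g h F : R -> R.

(** The kernel that makes [\int_0^x f] an integral over the whole of ]a, b[,
    whatever the sign of [x]: it is 1 for 0 <= y < x, -1 for x <= y < 0, and 0
    elsewhere. *)
Definition ker (x y : R) : R := (y < x)%R%:R - (y < 0)%R%:R.

Definition prim f x := Int a b (fun y => ker x y * f y).

Lemma ker_norm x y : `|ker x y| <= 1.
Proof.
rewrite /ker; case: ltP => _; case: ltP => _; rewrite ?subrr ?subr0 ?sub0r ?normrN;
  by rewrite ?normr0 ?normr1 ?ler01.
Qed.

Lemma ker_le x y : ker x y != 0 -> `|y| <= `|x|.
Proof.
rewrite /ker; case: (ltP y x) => yx; case: (ltP y 0) => y0; rewrite ?subrr ?eqxx// => _.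
- by rewrite ger0_norm// ger0_norm// ltW// (le_lt_trans y0).
- by rewrite ltr0_norm// ltr0_norm ?lerN2// (le_lt_trans yx).
Qed.

Lemma normr_ker_ge0 x y : 0 <= x -> `|ker x y| = ker x y.
Proof.
move=> x0; rewrite ger0_norm// /ker; case: (ltP y 0) => y0; rewrite ?subr0 ?ler0n//.
by rewrite (lt_le_trans y0 x0) subrr.
Qed.

Lemma normr_ker_le0 x y : x <= 0 -> `|ker x y| = - ker x y.
Proof.
move=> x0; rewrite ler0_norm// /ker; case: (ltP y x) => yx; last by rewrite sub0r oppr_le0 ler0n.
by rewrite (lt_le_trans yx x0) subrr.
Qed.

Lemma measurable_lt_natr (x : R) : measurable_fun `]a, b[ (fun y : R => (y < x)%R%:R : R).
Proof.
rewrite (_ : (fun y => _) = \1_(`]-oo, x[%classic : set R)).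
  exact: measurable_indic.
by apply/funext => y; rewrite indicE mem_setE in_itv.
Qed.

Lemma measurable_ker x : measurable_fun `]a, b[ (ker x).
Proof. by apply: measurable_funB; exact: measurable_lt_natr. Qed.

Lemma integ_ker x f : integ a b f -> integ a b (fun y => ker x y * f y).
Proof.
move=> hf; apply: (@integ_mul _ _ _ f (ker x) 1 hf); first exact: measurable_ker.
by move=> y _; exact: ker_norm.
Qed.

Lemma integ_normr_ker x f : integ a b f -> integ a b (fun y => `|ker x y| * f y).
Proof.
move=> hf; apply: (@integ_mul _ _ _ f (fun y => `|ker x y|) 1 hf).
  by apply: measurableT_comp => //; exact: measurable_ker.
by move=> y _; rewrite normr_id; exact: ker_norm.
Qed.

Lemma eq_prim f g x : (forall y, y \in `]a, b[ -> f y = g y) -> prim f x = prim g x.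
Proof. by move=> fg; apply: eq_Int => y yD; rewrite fg. Qed.

Lemma prim_ae f g x : measurable_fun `]a, b[ f -> measurable_fun `]a, b[ g ->
  aeeqr a b f g -> prim f x = prim g x.
Proof.
move=> mf mg fg; apply: Int_ae; try by apply: measurable_funM => //; exact: measurable_ker.
by apply: ae_sub fg => y h yD; rewrite h.
Qed.

Lemma primD f g x : integ a b f -> integ a b g ->
  prim (fun y => f y + g y) x = prim f x + prim g x.
Proof.
move=> hf hg; rewrite /prim -IntD; try exact: integ_ker.
by apply: eq_Int => y _; rewrite mulrDr.
Qed.

Lemma primZ c f x : integ a b f -> prim (fun y => c * f y) x = c * prim f x.
Proof.
move=> hf; rewrite /prim -IntZ; last exact: integ_ker.
by apply: eq_Int => y _; rewrite mulrCA.
Qed.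

Lemma primN f x : integ a b f -> prim (fun y => - f y) x = - prim f x.
Proof. by move=> hf; rewrite -mulN1r -primZ//; apply: eq_prim => y _; rewrite mulN1r. Qed.

Lemma primB f g x : integ a b f -> integ a b g ->
  prim (fun y => f y - g y) x = prim f x - prim g x.
Proof. by move=> hf hg; rewrite primD ?primN//; exact: integN. Qed.

Lemma prim_norm_ker f x : integ a b f ->
  `|prim f x| <= Int a b (fun y => `|ker x y| * `|f y|).
Proof.
move=> hf; rewrite (le_trans (Int_norm (integ_ker x hf)))// le_eqVlt.
by apply/orP; left; apply/eqP; apply: eq_Int => y _; rewrite normrM.
Qed.

Lemma prim_norm_le f x : integ a b f -> `|prim f x| <= Int a b (fun y => `|f y|).
Proof.
move=> hf; rewrite (le_trans (prim_norm_ker _ hf))//; apply: Int_le.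
- exact/integ_normr_ker/integ_norm.
- exact: integ_norm.
- by move=> y _; rewrite ler_piMl// ker_norm.
Qed.

Lemma prim_homo f : integ a b f -> (forall y, y \in `]a, b[ -> 0 <= f y) ->
  {homo prim f : x y / x <= y}.
Proof.
move=> hf f0 x y xy; apply: Int_le; try exact: integ_ker.
move=> z zD; rewrite ler_wpM2r ?f0// /ker lerD2r ler_nat.
by case: (ltP z x) => // zx; rewrite (lt_le_trans zx xy).
Qed.

(** The primitive of a nonnegative function is monotone, and [f] is half the
    difference of the nonnegative functions [|f| + f] and [|f| - f]. *)
Lemma measurable_prim f : integ a b f -> measurable_fun `]a, b[ (prim f).
Proof.
move=> hf; have hn := integ_norm hf.
rewrite (_ : prim f = fun x => 2^-1 * (prim (fun y => `|f y| + f y) x - prim (fun y => `|f y| - f y) x)).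
  apply: measurable_funM => //; apply: measurable_funB.
    apply: nondecreasing_measurable; first exact: measurable_oo.
    apply: prim_homo; first exact: integD.
    by move=> y _; rewrite -lerBlDr sub0r -normrN ler_norm.
  apply: nondecreasing_measurable; first exact: measurable_oo.
  apply: prim_homo; first exact: integB.
  by move=> y _; rewrite subr_ge0 ler_norm.
by apply/funext => x; rewrite primD// primB//; field.
Qed.

Lemma integ_prim f : integ a b f -> integ a b (prim f).
Proof.
move=> hf; apply: integ_bounded; first exact: measurable_prim.
by move=> x _; exact: prim_norm_le.
Qed.

Lemma integ_continuous f : continuous f -> integ a b f.
Proof.
move=> cf.
have : {within `[a, b], continuous f} by exact: continuous_subspaceT.
move=> /(continuous_compact_integrable (@segment_compact _ a b)).
by apply: integrableS => //; exact: subset_itv_oo_cc.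
Qed.

Lemma bounded_continuous f : continuous f ->
  exists2 M, 0 <= M & forall x, x \in `]a, b[ -> `|f x| <= M.
Proof.
move=> cf.
have : {within `[a, b], continuous f} by exact: continuous_subspaceT.
move=> /(continuous_compact)/(_ (@segment_compact _ a b))/compact_bounded[M [_ hM]].
exists (`|M| + 1); first by rewrite addr_ge0.
move=> y yab; apply: (hM (`|M| + 1)); first by rewrite ltr_pwDr// ler_norm.
by exists y => //=; apply: subset_itv_oo_cc.
Qed.

(** The fundamental theorem of calculus, with the upper limit [c] expressed as
    a cut-off of the integrand. *)
Lemma Int_lt_deriv F f c : (forall x : R, is_derive x 1 F (f x)) -> continuous f ->
  c \in `[a, b] -> Int a b (fun y => (y < c)%R%:R * f y) = F c - F a.
Proof.
move=> dF cf; rewrite in_itv/= => /andP[ac cb].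
have cF : continuous F.
  by move=> x; apply: differentiable_continuous; apply/derivable1_diffP; case: (dF x).
have -> : Int a b (fun y => (y < c)%R%:R * f y) = \int[@lebesgue_measure R]_(y in `]a, c[) f y.
  rewrite /Int -[in RHS](_ : `]a, b[%classic `&` `]-oo, c[%classic = `]a, c[%classic); last first.
    apply/seteqP; split => y /=; rewrite !in_itv/=; first by move=> [/andP[-> _] ->].
    by move=> /andP[-> yc]; rewrite yc (lt_le_trans yc cb).
  rewrite Rintegral_mkcondr; apply: eq_Rintegral => y _.
  rewrite patchE mem_setE in_itv/=; case: (y < c); by rewrite ?mul1r ?mul0r.
have := cf; move: ac; rewrite le_eqVlt => /predU1P[<- _|ac _].
  by rewrite subrr set_itv_ge ?bnd_simp ?lexx// Rintegral_set0.
have ic : (@lebesgue_measure R).-integrable `[a, c] (EFin \o f).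
  apply: continuous_compact_integrable; first exact: segment_compact.
  exact: continuous_subspaceT.
rewrite Rintegral_itv_obnd_cbnd; last by apply: integrableS ic => //; exact: subset_itv_oo_cc.
rewrite Rintegral_itv_bndo_bndc; last by apply: integrableS ic => //; exact: subset_itv_co_cc.
rewrite /Rintegral (@continuous_FTC2 _ f F)//.
- exact: continuous_subspaceT.
- split; [by move=> x _; case: (dF x)| |].
  + by apply: cvg_at_right_filter; exact: cF.
  + by apply: cvg_at_left_filter; exact: cF.
- by move=> x _; rewrite derive1E derive_val.
Qed.

Context (ha : a <= 0) (hb : 0 <= b).

Lemma prim_deriv F f x : (forall x : R, is_derive x 1 F (f x)) -> continuous f ->
  x \in `[a, b] -> prim f x = F x - F 0.
Proof.
move=> dF cf xab; have hf := integ_continuous cf.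
have Il c : integ a b (fun y => (y < c)%R%:R * f y).
  apply: (@integ_mul _ _ _ f _ 1) => //; first exact: measurable_lt_natr.
  by move=> y _; case: ltP; rewrite ?normr1 ?normr0.
rewrite /prim (_ : Int a b _ = Int a b (fun y => (y < x)%R%:R * f y) - Int a b (fun y => (y < 0)%R%:R * f y)).
  by rewrite !(Int_lt_deriv dF)//; [ring|rewrite in_itv/= ha].
by rewrite -IntB//; apply: eq_Int => y _; rewrite mulrBl.
Qed.

Lemma Int_normr_ker x : x \in `[a, b] -> Int a b (fun y => `|ker x y|) = `|x|.
Proof.
move=> xab.
have J1 : prim (fun=> 1) x = x.
  rewrite (prim_deriv (F := id)) ?subr0//; exact: cst_continuous.
have [x0|x0] := leP 0 x.
  rewrite ger0_norm// -[RHS]J1; apply: eq_Int => y _.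
  by rewrite normr_ker_ge0// mulr1.
rewrite ltr0_norm// -[in RHS]J1 -primN; last exact: integ_cst.
by apply: eq_Int => y _; rewrite normr_ker_le0 ?ltW// mulrN1.
Qed.

(** Only the values of [f] between 0 and [x] enter the primitive at [x]. *)
Lemma prim_near_bound f M x : integ a b f -> x \in `[a, b] ->
  (forall y, y \in `]a, b[ -> `|y| <= `|x| -> `|f y| <= M) -> `|prim f x| <= M * `|x|.
Proof.
move=> hf xab fM; rewrite (le_trans (prim_norm_ker _ hf))// -(Int_normr_ker xab) -IntZ; last first.
  have := integ_normr_ker x (integ_cst a b 1).
  by apply: eq_integ => y _; rewrite mulr1.
apply: Int_le.
- exact/integ_normr_ker/integ_norm.
- have := integ_normr_ker x (integ_cst a b M).
  by apply: eq_integ => y _; rewrite mulrC.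
- move=> y yD; rewrite mulrC; have [->|kn0] := eqVneq (ker x y) 0; first by rewrite normr0 !mulr0.
  by rewrite ler_wpM2r// fM// ker_le.
Qed.

(** Continuity of the primitive at 0: it holds for bounded [f], and a
    polynomial approximates [f] in L^1, hence its primitive uniformly. *)
Lemma prim_small f e : a < b -> integ a b f -> 0 < e ->
  exists2 d, 0 < d & forall x, x \in `[a, b] -> `|x| < d -> `|prim f x| <= e.
Proof.
move=> ab hf e0; have e2 : 0 < e / 2 by rewrite divr_gt0.
have [p hp] := poly_dense ab hf e2.
have cp : continuous (horner p) by exact: continuous_horner.
have ip := integ_continuous cp.
have [M M0 hM] := bounded_continuous cp.
exists (e / 2 / (M + 1)); first by rewrite divr_gt0// ltr_wpDl.
move=> x xab xd; rewrite (_ : prim f x = prim (fun y => f y - p.[y]) x + prim (horner p) x); last first.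
  by rewrite primB// subrK.
rewrite (le_trans (ler_normD _ _))// [leRHS]splitr lerD//.
  by rewrite (le_trans (prim_norm_le _ _))//; exact: integB.
rewrite (le_trans (@prim_near_bound _ M x ip xab _))//.
  by move=> y yD _; exact: hM.
rewrite mulrC (@le_trans _ _ (`|x| * (M + 1)))// ?ler_wpM2l ?lerDl//.
by rewrite -ler_pdivlMr ?ltr_wpDl// ltW.
Qed.

Lemma prim_horner (P : {poly R}) x : x \in `[a, b] ->
  prim (horner P^`()) x = P.[x] - P.[0].
Proof.
by move=> xab; apply: prim_deriv => //; exact: continuous_horner.
Qed.

Lemma poly_primitive (p : {poly R}) : exists P : {poly R}, P^`() = p.
Proof.
exists (\poly_(i < (size p).+1) (p`_i.-1 / i%:R)).
apply/polyP => i; rewrite coef_deriv coef_poly ltnS /=.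
case: ltnP => [_|si]; last by rewrite mul0rn nth_default.
by rewrite -[LHS]mulr_natr divfK// pnatr_eq0.
Qed.

End Primitive.

(** * Gronwall's inequality with an integrable coefficient *)
Section Gronwall.
Context {R : realType} (a b : R) (ab : a < b) (ha : a <= 0) (hb : 0 <= b).
Implicit Types f g h F : R -> R.

Lemma is_derive_expRZ (c x : R) :
  is_derive x 1 (fun y => expR (c * y)) (c * expR (c * x)).
Proof.
have dc : is_derive x 1 (fun y : R => c * y) c.
  rewrite -[X in is_derive _ _ _ X]mulr1 -[X in is_derive _ _ _ X]/(c *: 1).
  exact: is_deriveZ.
have := @is_derive1_comp R expR (fun y : R => c * y) x _ _ (is_derive_expR _) dc.
by move=> dd; apply: is_derive_eq; rewrite mulrC.
Qed.

Lemma continuous_expRZ (c : R) : continuous (fun y : R => expR (c * y)).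
Proof.
move=> x; apply: differentiable_continuous; apply/derivable1_diffP.
by case: (is_derive_expRZ c x).
Qed.

Lemma prim_expR (c x : R) : c != 0 -> x \in `[a, b] ->
  prim a b (fun y => expR (c * y)) x = (expR (c * x) - 1) / c.
Proof.
move=> c0 xab; have dF (y : R) : is_derive y 1 (fun y => c^-1 * expR (c * y)) (expR (c * y)).
  have dd := is_deriveZ c^-1 (is_derive_expRZ c y).
  by apply: is_derive_eq; rewrite /GRing.scale /= mulKf.
rewrite (prim_deriv ha hb dF)//; last exact: continuous_expRZ.
by rewrite mulr0 expR0; field.
Qed.

(** Exponential weights make the integration operator small: its norm on
    functions weighted by [expR (c * `|y|)] is at most [1 / c]. *)
Lemma Int_ker_expR (c x : R) : 0 < c -> x \in `[a, b] ->
  Int a b (fun y => `|ker x y| * expR (c * `|y|)) <= expR (c * `|x|) / c.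
Proof.
move=> c0 xab; have cN0 : c != 0 by rewrite gt_eqF.
have [x0|x0] := leP 0 x.
  rewrite [leLHS](_ : _ = prim a b (fun y => expR (c * y)) x).
    by rewrite prim_expR// ger0_norm// ler_wpM2r ?invr_ge0 ?(ltW c0)// gerBl.
  apply: eq_Int => y _; rewrite normr_ker_ge0//.
  rewrite /ker; case: (ltP y 0) => y0; last by rewrite ger0_norm.
  by rewrite (lt_le_trans y0 x0) subrr !mul0r.
rewrite [leLHS](_ : _ = - prim a b (fun y => expR (- c * y)) x).
  rewrite prim_expR ?oppr_eq0// ltr0_norm// invrN mulrN opprK mulrN mulNr.
  by rewrite ler_wpM2r ?invr_ge0 ?(ltW c0)// gerBl.
rewrite -primN; last exact/integ_continuous/continuous_expRZ.
apply: eq_Int => y _; rewrite normr_ker_le0 ?ltW// mulrN mulNr; congr (- _).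
rewrite /ker; case: (ltP y x) => yx; first by rewrite (lt_trans yx x0) subrr !mul0r.
case: (ltP y 0) => y0; last by rewrite subrr !mul0r.
by rewrite ltr0_norm// mulrN mulNr.
Qed.

(** Split [Q] into a bounded part [p] and a part of integral at most 1/4. In
    the weight [expR (c * `|x|)] with [c] large compared with [p], each part
    contributes at most a quarter of a bound [S] for the weighted [V], so that
    [S] may be replaced by [S / 2 + E]. Iterating from the bound [M] leaves
    [2 E]. The constant depends on [Q] only, not on [M]. *)
Lemma gronwall Q : integ a b Q -> (forall x, x \in `]a, b[ -> 0 <= Q x) ->
  exists2 C : R, 0 <= C & forall (V : R -> R) (E M : R), 0 <= E -> measurable_fun `]a, b[ V ->
    (forall x, x \in `]a, b[ -> 0 <= V x <= M) ->
    (forall x, x \in `]a, b[ ->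
       V x <= Int a b (fun y => `|ker x y| * (Q y * V y)) + E) ->
    forall x, x \in `]a, b[ -> V x <= C * E.
Proof.
move=> hQ Q0; have e4 : 0 < 4^-1 :> R by rewrite invr_gt0.
have [p hp] := poly_dense ab hQ e4.
have cp : continuous (horner p) by exact: continuous_horner.
have ip := integ_continuous a b cp.
have [H H0 hH] := bounded_continuous a b cp.
(* [H / c < 1 / 4], and [c] is positive even when [H] is 0. *)
pose c := 4 * H + 1; have c0 : 0 < c by rewrite ltr_wpDl// mulr_ge0.
exists (2 * expR (c * (b - a))); first by rewrite mulr_ge0// expR_ge0.
move=> V E M E0 mV VM hV.
have iV : integ a b V.
  by apply: (@integ_bounded _ _ _ _ M) => // x /VM/andP[? ?]; rewrite ger0_norm.
have iQV : integ a b (fun y => Q y * V y).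
  have : integ a b (fun y => V y * Q y).
    by apply: (@integ_mul _ _ _ _ _ M) => // x /VM/andP[? ?]; rewrite ger0_norm.
  by apply: eq_integ => y _; rewrite mulrC.
have iexp : integ a b (fun y => expR (c * `|y|)).
  apply: integ_continuous => x.
  apply: (@continuous_comp _ _ _ (fun y : R => `|y|) (fun y => expR (c * y))).
    exact: norm_continuous.
  exact: continuous_expRZ.
have step S : 0 <= S -> (forall x, x \in `]a, b[ -> V x <= S * expR (c * `|x|)) ->
  forall x, x \in `]a, b[ -> V x <= (S / 2 + E) * expR (c * `|x|).
  move=> S0 hS x xD; have xab : x \in `[a, b] by apply: subset_itv_oo_cc.
  rewrite (le_trans (hV _ xD))// mulrDl lerD//; last first.
    by rewrite ler_peMr// -expR0 ler_expR mulr_ge0// ltW.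
  set e := expR (c * `|x|); have e0 : 0 < e by rewrite expR_gt0.
  apply: (@le_trans _ _ (Int a b (fun y => S * e * `|Q y - p.[y]| +
     H * S * (`|ker x y| * expR (c * `|y|))))).
    apply: Int_le.
    - exact: integ_normr_ker.
    - apply: integD; first exact/integZ/integ_norm/integB.
      exact/integZ/integ_normr_ker.
    - move=> y yD; have [k0|k0] := eqVneq (ker x y) 0.
        rewrite k0 normr0 !mul0r mulr0 addr0.
        by rewrite mulr_ge0// mulr_ge0// ltW.
      have kx := ker_le k0; have k1 := ker_norm x y.
      have ey : expR (c * `|y|) <= e by rewrite ler_expR ler_wpM2l// ltW.
      have Vy := hS _ yD; have V0 : 0 <= V y by case/andP: (VM _ yD).
      have py : Q y <= `|Q y - p.[y]| + H.
        rewrite (le_trans (ler_norm _))// (le_trans _ (lerD (lexx _) (hH _ yD)))//.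
        by rewrite (le_trans _ (ler_normD _ _))// subrK.
      have ey0 : 0 <= expR (c * `|y|) by rewrite expR_ge0.
      apply: (@le_trans _ _ (`|ker x y| * ((`|Q y - p.[y]| + H) * V y))).
        by rewrite ler_wpM2l// ler_wpM2r.
      rewrite [leLHS](_ : _ = `|ker x y| * (`|Q y - p.[y]| * V y) + H * (`|ker x y| * V y)); last by ring.
      rewrite lerD//.
        rewrite -[leRHS]mul1r ler_pM ?mulr_ge0//.
        by rewrite mulrC ler_wpM2r// (le_trans Vy)// ler_wpM2l.
      by rewrite -mulrA ler_wpM2l// mulrCA ler_wpM2l.
  rewrite IntD; [|exact/integZ/integ_norm/integB|exact/integZ/integ_normr_ker].
  rewrite !IntZ; [|exact/integ_normr_ker|exact/integ_norm/integB].
  have I1 := Int_ker_expR c0 xab.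
  rewrite -/e in I1.
  have I2 : H * S * Int a b (fun y => `|ker x y| * expR (c * `|y|)) <= S * e / 4.
    rewrite (le_trans (ler_wpM2l _ I1)) ?mulr_ge0//.
    rewrite [leLHS](_ : _ = S * e * (H / c)); last by ring.
    have Hc : H / c <= 4^-1 by rewrite ler_pdivrMr// /c; lra.
    by rewrite ler_wpM2l// mulr_ge0// ltW.
  have I3 : S * e * Int a b (fun y => `|Q y - p.[y]|) <= S * e / 4.
    by rewrite ler_wpM2l// mulr_ge0// ltW.
  rewrite (le_trans (lerD I3 I2))// le_eqVlt; apply/orP; left; apply/eqP.
  by field.
have iter n : forall x, x \in `]a, b[ -> V x <= (M / 2 ^+ n + 2 * E) * expR (c * `|x|).
  elim: n => [|n IH] x xD.
    have /andP[V0 Vx] := VM _ xD; have M0 := le_trans V0 Vx.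
    rewrite expr0 divr1 (le_trans Vx)// (@le_trans _ _ (M + 2 * E))//.
      by rewrite lerDl mulr_ge0.
    rewrite ler_peMr ?addr_ge0 ?mulr_ge0// -expR0 ler_expR mulr_ge0// ltW//.
  have /andP[V0 Vx] := VM _ xD; have M0 := le_trans V0 Vx.
  have := step (M / 2 ^+ n + 2 * E) _ IH x xD.
  rewrite (_ : _ / 2 + E = M / 2 ^+ n.+1 + 2 * E); first apply.
    by rewrite addr_ge0 ?mulr_ge0// invr_ge0 exprn_ge0.
  by rewrite exprS; field.
move=> x xD; have /andP[V0 Vx] := VM _ xD; have M0 := le_trans V0 Vx.
have xle : expR (c * `|x|) <= expR (c * (b - a)).
  rewrite ler_expR ler_wpM2l ?(ltW c0)//.
  by move: xD ha hb; rewrite in_itv/= ler_norml => /andP[? ?] ? ?; apply/andP; split; lra.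
set e := expR (c * (b - a)) in xle *; have e0 : 0 < e by rewrite expR_gt0.
rewrite leNgt; apply/negP => Vlt.
pose d := V x - 2 * e * E; have d0 : 0 < d by rewrite subr_gt0.
pose n := Num.truncn (M * e / d).
have := iter n.+1 x xD.
apply/negP; rewrite -ltNge (@le_lt_trans _ _ ((M / 2 ^+ n.+1 + 2 * E) * e))//.
  by rewrite ler_wpM2l// addr_ge0 ?mulr_ge0// invr_ge0 exprn_ge0.
rewrite mulrDl -ltrBrDr (_ : V x - _ = d); last by rewrite /d; ring.
rewrite mulrAC ltr_pdivrMr ?exprn_gt0// -ltr_pdivrMl// [ltLHS]mulrC.
apply: (lt_le_trans (truncnS_gt _)); rewrite -/n -natrX ler_nat.
exact/ltnW/ltn_expl.
Qed.

End Gronwall.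

(** * Smooth functions *)
Section Smooth.
Context {R : realType}.
Implicit Types f g h F : R -> R.

Lemma is_derive_mul f g (x df dg : R) : is_derive x 1 f df -> is_derive x 1 g dg ->
  is_derive x 1 (fun y => f y * g y) (df * g x + f x * dg).
Proof.
move=> hf hg; have := is_deriveM hf hg => hM; apply: is_derive_eq.
by rewrite /GRing.scale /=; ring.
Qed.

Lemma is_derive_comp_affine f (s c x df : R) : is_derive (s * x + c) 1 f df ->
  is_derive x 1 (fun y => f (s * y + c)) (df * s).
Proof.
move=> hf; apply: (@is_derive1_comp R f (fun y => s * y + c)).
have h1 : is_derive x 1 (fun y : R => s * y) s.
  rewrite -[X in is_derive _ _ _ X]mulr1 -[X in is_derive _ _ _ X]/(s *: 1).
  exact: is_deriveZ.
rewrite -[X in is_derive _ _ _ X]addr0.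
exact: is_deriveD h1 (is_derive_cst _ _ _).
Qed.

Lemma is_derive_continuous f g : (forall x : R, is_derive x 1 f (g x)) -> continuous f.
Proof.
by move=> fg x; apply: differentiable_continuous; apply/derivable1_diffP; case: (fg x).
Qed.

(** Each factor [y] costs [2 / t] times half of the exponent, as
    [t / 2 * y <= expR (t / 2 * y)]. *)
Lemma poly_exp_bound (p : {poly R}) (t : R) : 0 < t ->
  exists2 C, 0 <= C & forall y, 0 <= y -> `|p.[y]| <= C * expR (t * y).
Proof.
elim/poly_ind: p t => [|p c IH] t t0.
  by exists 0 => // y _; rewrite horner0 normr0 mul0r.
have t2 : 0 < t / 2 by rewrite divr_gt0.
have [C C0 hC] := IH _ t2.
exists (C / (t / 2) + `|c|); first by rewrite addr_ge0// divr_ge0// ltW.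
move=> y y0; rewrite !hornerE (le_trans (ler_normD _ _))// mulrDl lerD//; last first.
  by rewrite ler_peMr// -expR0 ler_expR mulr_ge0// ltW.
rewrite normrM (ger0_norm y0).
have ye : y <= (t / 2)^-1 * expR (t / 2 * y).
  rewrite ler_pdivlMl// (le_trans _ (expR_ge1Dx _))//; lra.
rewrite (le_trans (ler_pM _ _ (hC _ y0) ye))//.
rewrite [leLHS](_ : _ = C / (t / 2) * (expR (t / 2 * y) * expR (t / 2 * y))); last by ring.
by rewrite -expRD (_ : _ + _ = t * y)//; field.
Qed.

(** These functions, all flat at 0, include [exp(-t/x)] and are stable under
    differentiation, which is what makes their smoothness an induction. *)
Definition flat (t : R) (p : {poly R}) (x : R) : R :=
  if 0 < x then p.[x^-1] * expR (- t * x^-1) else 0.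

Lemma flat_is_derive (t : R) p (x : R) : 0 < t ->
  is_derive x 1 (flat t p) (flat t ('X^2 * (t *: p - p^`())) x).
Proof.
move=> t0; set q := 'X^2 * _; have [x0|x0|->] := ltgtP x 0.
- rewrite (_ : flat t q x = 0); last by rewrite /flat ltNge (ltW x0).
  apply: (@near_eq_is_derive _ _ _ (cst 0)).
    near=> y; rewrite /flat ltNge; case: leP => //.
    by rewrite ltNge => /negP[]; near: y; exact: lt_le_nbhsl.
- rewrite (_ : flat t q x = q.[x^-1] * expR (- t * x^-1)); last by rewrite /flat x0.
  (* to the right of 0 the chain rule applies to the defining formula *)
  have hn : \forall y \near x, p.[y^-1] * expR (- t * y^-1) = flat t p y.
    by near=> y; rewrite /flat ifT//; near: y; exact: lt_nbhsr.
  have xn0 : x != 0 by rewrite gt_eqF.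
  have dV : is_derive x 1 (fun y : R => y^-1) (- x ^- 2).
    have := is_deriveV xn0 (is_derive_id x 1) => h; apply: is_derive_eq.
    by rewrite /GRing.scale /= mulr1.
  have dp : is_derive x 1 (fun y : R => p.[y^-1]) (p^`().[x^-1] * - x ^- 2).
    have dP : is_derive (x^-1) 1 (horner p) (p^`().[x^-1]).
      by rewrite derivE derive1E; exact: DeriveDef.
    exact: (@is_derive1_comp R (horner p) (fun y => y^-1) x _ _ dP dV).
  have de : is_derive x 1 (fun y : R => expR (- t * y^-1))
      (- t * expR (- t * x^-1) * - x ^- 2).
    exact: (@is_derive1_comp R (fun y => expR (- t * y)) (fun y => y^-1) x _ _
      (is_derive_expRZ _ _) dV).
  apply: (near_eq_is_derive hn).
  have := is_derive_mul dp de => h; apply: is_derive_eq.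
  by rewrite /q !hornerE /=; field.
- rewrite (_ : flat t q 0 = 0); last by rewrite /flat ltxx.
  (* the difference quotient at 0 is O(h): bound [p(y) y^2] at [y = 1 / h] *)
  have [C C0 hC] := @poly_exp_bound (p * 'X^2) _ t0.
  have hlim : h^-1 *: (flat t p (h *: 1 + 0) - flat t p 0) @[h --> (0:R)^'] --> (0 : R).
    apply/cvgr0Pnorm_le => e e0; near=> h.
    rewrite (_ : flat t p 0 = 0) ?subr0; last by rewrite /flat ltxx.
    rewrite /GRing.scale /= mulr1 addr0 /flat.
    case: ltP => h0; last by rewrite mulr0 normr0 ltW.
    rewrite normrM normfV (gtr0_norm h0) normrM (ger0_norm (expR_ge0 _)).
    have hi : 0 <= h^-1 by rewrite invr_ge0 ltW.
    have := hC _ hi; rewrite hornerM hornerXn normrM (@ger0_norm _ (h^-1 ^+ 2)) ?exprn_ge0// => hb.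
    have hE : 0 < expR (t * h^-1) by rewrite expR_gt0.
    have hCe : C * h <= e.
      rewrite (@le_trans _ _ ((C + 1) * `|h|))//.
        by rewrite gtr0_norm// ler_wpM2r ?lerDl// ltW.
      rewrite mulrC -ler_pdivlMr ?ltr_wpDl//; apply: ltW; near: h.
      apply: dnbhs0_lt; by rewrite divr_gt0// ltr_wpDl.
    rewrite (le_trans _ hCe)// mulNr expRN ler_pdivrMl// ler_pdivrMr//.
    rewrite -(ler_pM2r (exprn_gt0 2 (_ : 0 < h^-1))) ?invr_gt0//.
    rewrite (le_trans hb)// le_eqVlt; apply/orP; left; apply/eqP; field.
    by rewrite gt_eqF.
  apply: DeriveDef; first by apply/cvg_ex; exists 0.
  exact/cvg_lim.
Unshelve. all: by end_near. Qed.

(** Not every smooth function, but a class stable under differentiation and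
    rich enough to contain the cut-off functions and their combinations. *)
Inductive smooth : (R -> R) -> Prop :=
| smooth_flat t p s c : 0 < t -> smooth (fun x => flat t p (s * x + c))
| smooth_cst c : smooth (fun=> c)
| smooth_add f g : smooth f -> smooth g -> smooth (fun x => f x + g x)
| smooth_mul f g : smooth f -> smooth g -> smooth (fun x => f x * g x).

Lemma smooth_is_derive f : smooth f -> exists2 g, smooth g & forall x : R, is_derive x 1 f (g x).
Proof.
elim=> [t p s c t0|c|{}f g _ [f' sf df] _ [g' sg dg]|{}f g sf [f' sf' df] sg [g' sg' dg]].
- exists (fun x => flat t ('X^2 * (t *: p - p^`())) (s * x + c) * s).
    by apply: smooth_mul; [exact: smooth_flat|exact: smooth_cst].
  by move=> x; apply: is_derive_comp_affine; exact: flat_is_derive.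
- by exists (fun=> 0); [exact: smooth_cst|move=> x; exact: is_derive_cst].
- exists (fun x => f' x + g' x); first exact: smooth_add.
  by move=> x; exact: is_deriveD.
- exists (fun x => f' x * g x + f x * g' x); last by move=> x; exact: is_derive_mul.
  by apply: smooth_add; exact: smooth_mul.
Qed.

Lemma derive1_eq f g : (forall x : R, is_derive x 1 f (g x)) -> derive1 f = g.
Proof. by move=> fg; apply/funext => x; rewrite derive1E derive_val. Qed.

Lemma derive1nSr n f : derive1n n.+1 f = derive1n n (derive1 f).
Proof. by rewrite /derive1n iterSr. Qed.

Lemma smooth_derivable f : smooth f -> forall n (x : R), derivable (derive1n n f) x 1.
Proof.
move=> sf n; elim: n f sf => [|n IH] f sf x; have [g sg fg] := smooth_is_derive sf.
  by case: (fg x).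
by rewrite derive1nSr (derive1_eq fg); exact: IH.
Qed.

(** A primitive of a member of the class has all its derivatives even where it
    leaves the class. *)
Lemma smooth_primitive f g : (forall x : R, is_derive x 1 f (g x)) -> smooth g ->
  forall n (x : R), derivable (derive1n n f) x 1.
Proof.
move=> fg sg [|n] x; first by case: (fg x).
by rewrite derive1nSr (derive1_eq fg); exact: smooth_derivable.
Qed.

Lemma smooth_continuous f : smooth f -> continuous f.
Proof. by move=> /smooth_is_derive[g _]; exact: is_derive_continuous. Qed.

End Smooth.

(** * Test functions and the fundamental lemma *)
Section Test.
Context {R : realType} (a b : R) (ab : a < b).
Implicit Types f g h F psi : R -> R.
Notation mu := (@lebesgue_measure R).
Notation test := (@test_function R a b).

Lemma test_intro psi (c d : R) : a < c -> d < b ->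
  (forall n (x : R), derivable (derive1n n psi) x 1) ->
  (forall x, psi x != 0 -> c <= x <= d) -> test psi.
Proof.
move=> ac db smooth supp; split=> //.
have : closure [set x | psi x != 0] `<=` `[c, d].
  rewrite [X in _ `<=` X](_ : _ = closure `[c, d]%classic); last first.
    by apply/closure_id; exact: interval_closed.
  by apply: closure_subset => x /= /supp; rewrite in_itv.
move=> /subset_trans; apply=> x /=; rewrite !in_itv/= => /andP[cx xd].
by rewrite (lt_le_trans ac)//= (le_lt_trans xd).
Qed.

(** The endpoints are not in the closed support, hence at positive distance
    from it. *)
Lemma test_support psi : test psi ->
  exists c d, [/\ a < c, d < b, c < d & forall x, psi x != 0 -> c <= x <= d].
Proof.
move=> [_ supp]; set S := [set x | psi x != 0] in supp.
have aN : (closed (closure S)) by exact: closed_closure.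
have away (z : R) : z = a \/ z = b -> exists2 e, 0 < e & forall x, S x -> e <= `|z - x|.
  move=> zab; have : nbhs z (~` closure S).
    apply: open_nbhs_nbhs; split; first exact: closed_openC.
    by move=> /supp /=; rewrite in_itv/=; case: zab => ->; rewrite ltxx ?andbF.
  move=> [e /= e0 he]; exists e => // x Sx; rewrite leNgt; apply/negP => /he; apply.
  exact: subset_closure.
have [e e0 he] := away a (or_introl erefl).
have [e' e0' he'] := away b (or_intror erefl).
pose r := Num.min (Num.min e e') ((b - a) / 4).
have r0 : 0 < r by rewrite !lt_min e0 e0' divr_gt0// subr_gt0.
have re : r <= e by rewrite ge_min ge_min lexx.
have re' : r <= e' by rewrite ge_min ge_min lexx orbT.
have rb : r <= (b - a) / 4 by rewrite ge_min lexx orbT.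
exists (a + r), (b - r); split; [by rewrite ltrDl|by rewrite gtrBl| |].
  by rewrite ltrBrDl; lra.
move=> x Sx; have Dx : `]a, b[%classic x by apply: supp; exact: subset_closure.
move: Dx; rewrite /= in_itv/= => /andP[ax xb].
have := he _ Sx; have := he' _ Sx.
by rewrite (distrC a) !gtr0_norm ?subr_gt0// => ? ?; apply/andP; split; lra.
Qed.

Lemma test_out psi x : test psi -> x \notin `]a, b[ -> psi x = 0.
Proof.
move=> [_ supp] xN; apply/eqP/contraT => px.
have : `]a, b[%classic x by apply: supp; exact: subset_closure.
by rewrite /= (negbTE xN).
Qed.

Lemma test_deriv psi : test psi -> test (derive1 psi).
Proof.
move=> tp; have [c [d [ac db cd supp]]] := test_support tp.
apply: (@test_intro _ c d) => //.
  by move=> n x; rewrite -derive1nSr; case: tp => + _; apply.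
move=> x; apply: contraNT => xN.
have : \forall y \near x, 0 = psi y.
  move: xN; rewrite negb_and -!ltNge => /orP[xc|dx].
    near=> y; apply/esym/eqP/contraT => /supp /andP[+ _].
    by rewrite leNgt => /negP[]; near: y; exact: lt_nbhsl.
  near=> y; apply/esym/eqP/contraT => /supp /andP[_ +].
  by rewrite leNgt => /negP[]; near: y; exact: lt_nbhsr.
move=> h0; have hE : 'D_1 (cst (0 : R)) x = 'D_1 psi x by exact: near_eq_derive h0.
by rewrite derive1E -hE derive_cst.
Unshelve. all: by end_near. Qed.

Lemma test_is_derive psi x : test psi -> is_derive x (1:R) psi (derive1 psi x).
Proof. by move=> [h _]; rewrite derive1E; apply: DeriveDef => //; exact: (h 0%N). Qed.

Lemma test_continuous psi : test psi -> continuous psi.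
Proof. by move=> tp; apply: is_derive_continuous => x; exact: test_is_derive. Qed.

(** The derivative of [F * psi] has integral 0 since [psi] vanishes at both
    ends. *)
Lemma test_by_parts F f psi : test psi -> (forall x : R, is_derive x 1 F (f x)) ->
  continuous f ->
  Int a b (fun x => F x * derive1 psi x) = - Int a b (fun x => f x * psi x).
Proof.
move=> tp dF cf; have cF := is_derive_continuous dF; have cp := test_continuous tp.
have cp' := test_continuous (test_deriv tp).
have dFp (x : R) := is_derive_mul (dF x) (test_is_derive x tp).
have cM g h : continuous g -> continuous h -> continuous (fun x => g x * h x).
  by move=> cg ch x; apply: cvgM; [exact: cg|exact: ch].
have cS : continuous (fun x => f x * psi x + F x * derive1 psi x).
  by move=> x; apply: cvgD; exact: cM.
have := Int_lt_deriv dFp cS (_ : b \in `[a, b]).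
rewrite in_itv/= lexx (ltW ab) => /(_ isT).
rewrite !(test_out tp) ?in_itv/= ?ltxx ?andbF// !mulr0 subrr.
rewrite (@eq_Int _ _ _ _ (fun x => f x * psi x + F x * derive1 psi x)).
  rewrite IntD; [|exact/integ_continuous/cM..].
  by move=> /eqP; rewrite addrC addr_eq0 => /eqP.
by move=> x; rewrite in_itv/= => /andP[_ ->]; rewrite mul1r.
Qed.

(** For [t] tending to 0 these increase to the indicator of ]c, d[, so that no
    normalisation or mollification is needed to reach indicators. *)
Definition cutoff (c d t : R) (x : R) : R :=
  flat t 1 (1 * x + (- c)) * flat t 1 (- 1 * x + d).

Lemma flat1 (t x : R) : flat t 1 x = if 0 < x then expR (- t * x^-1) else 0.
Proof. by rewrite /flat hornerE mul1r. Qed.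

Lemma smooth_cutoff c d t : 0 < t -> smooth (cutoff c d t).
Proof. by move=> t0; apply: smooth_mul; exact: smooth_flat. Qed.

Lemma cutoffE c d t x : c < x < d ->
  cutoff c d t x = expR (- t * ((x - c)^-1 + (d - x)^-1)).
Proof.
move=> /andP[cx xd]; rewrite /cutoff !flat1 mul1r mulN1r addrC [- x + d]addrC.
by rewrite !subr_gt0 xd [- c + x]addrC subr_gt0 cx -expRD mulrDr.
Qed.

Lemma cutoff_out c d t x : ~~ (c < x < d) -> cutoff c d t x = 0.
Proof.
rewrite negb_and /cutoff !flat1 mul1r mulN1r [- x + d]addrC !subr_gt0.
by case: ltP => _; [case: ltP => // _ _; rewrite mulr0|rewrite mul0r].
Qed.

Lemma cutoff_ge0 c d t x : 0 <= cutoff c d t x.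
Proof.
have [h|h] := boolP (c < x < d); first by rewrite cutoffE// expR_ge0.
by rewrite cutoff_out.
Qed.

Lemma cutoff_le1 c d t x : 0 < t -> cutoff c d t x <= 1.
Proof.
move=> t0; have [h|h] := boolP (c < x < d); last by rewrite cutoff_out.
rewrite cutoffE// -expR0 ler_expR mulNr oppr_le0 mulr_ge0 ?ltW//.
by case/andP: h => ? ?; rewrite addr_gt0// invr_gt0 subr_gt0.
Qed.

Lemma cutoff_test c d t : 0 < t -> a < c -> d < b -> test (cutoff c d t).
Proof.
move=> t0 ac db; apply: (test_intro ac db); first exact/smooth_derivable/smooth_cutoff.
move=> x bx; have [/andP[? ?]|h] := boolP (c < x < d); first by rewrite !ltW.
by rewrite cutoff_out ?eqxx in bx.
Qed.

Lemma cutoff_cvg c d x :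
  cutoff c d n.+1%:R^-1 x @[n --> \oo] --> ((c < x < d)%R%:R : R).
Proof.
have [h|h] := boolP (c < x < d); last first.
  by under eq_fun do rewrite cutoff_out//; exact: cvg_cst.
under eq_fun do rewrite cutoffE// mulNr -mulrN.
set k := - _.
have hk : n.+1%:R^-1 * k @[n --> \oo] --> (0 * k : R).
  by apply: cvgM; [exact: cvg_harmonic|exact: cvg_cst].
have : expR (n.+1%:R^-1 * k) @[n --> \oo] --> expR (0 * k).
  by apply: continuous_cvg; [exact: continuous_expR|exact: hk].
by rewrite mul0r expR0.
Qed.

Lemma Int_indic_cutoff f c d : integ a b f -> a < c -> d < b ->
  (forall psi, test psi -> smooth psi -> Int a b (fun x => psi x * f x) = 0) ->
  Int a b (fun x => (c < x < d)%R%:R * f x) = 0.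
Proof.
move=> hf ac db h0.
pose f_ n x := (cutoff c d n.+1%:R^-1 x * f x)%:E.
have mf := integ_measurable hf.
have [] := @dominated_convergence _ _ _ mu `]a, b[ (measurable_oo a b) f_
  (fun x => ((c < x < d)%R%:R * f x)%:E) (fun x => (`|f x|)%:E).
- move=> n; apply/measurable_EFinP; apply: measurable_funM => //.
  by apply: measurable_continuous; exact/smooth_continuous/smooth_cutoff.
- apply/measurable_EFinP; apply: measurable_funM => //.
  rewrite (_ : (fun x => _) = \1_(`]c, d[%classic : set R)).
    exact: measurable_indic.
  by apply/funext => y; rewrite indicE mem_setE in_itv.
- apply: ae_all => x _; apply: cvg_EFin; first by near=> n.
  by apply: cvgM; [exact: cutoff_cvg|exact: cvg_cst].
- exact: integ_norm.
- apply: ae_all => x n xD; rewrite /f_ /= lee_fin normrM ger0_norm ?cutoff_ge0//.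
  by rewrite ler_piMl// cutoff_le1.
move=> _ _; rewrite (_ : [sequence _]_n = cst 0%E); last first.
  apply/funext => n /=.
  have bi : integ a b (fun x => cutoff c d n.+1%:R^-1 x * f x).
    apply: (@integ_mul _ _ _ _ _ 1) => //.
      by apply: measurable_continuous; exact/smooth_continuous/smooth_cutoff.
    by move=> x _; rewrite ger0_norm ?cutoff_ge0// cutoff_le1.
  rewrite -(fineK (integrable_fin_num (measurable_oo a b) bi)); congr EFin.
  by apply: h0; [exact: cutoff_test|exact: smooth_cutoff].
by move=> /cvg_lim; rewrite lim_cst// /Int /Rintegral => <-.
Unshelve. all: by end_near. Qed.

(** The indefinite integral of [f] is constant on ]a, b[, and its derivative is
    [f] almost everywhere by Lebesgue's differentiation theorem. *)
Lemma aeeqr0_indic f : integ a b f ->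
  (forall c d, a < c -> c < d -> d < b -> Int a b (fun x => (c < x < d)%R%:R * f x) = 0) ->
  aeeqr a b f (fun=> 0).
Proof.
move=> hf h0; pose fab := f \_ `]a, b[%classic.
have iT : mu.-integrable setT (EFin \o fab).
  rewrite -restrict_EFin; apply/integrable_restrict => //=.
  by rewrite setTI.
have iS (i : interval R) : mu.-integrable [set` i] (EFin \o fab).
  have mi : measurable ([set` i] : set (measurableTypeR R)) by exact: measurable_itv.
  by have := @integrableS _ _ _ mu _ _ _ measurableT mi (@subsetT _ _) iT.
have := @FTC1Ny R fab (fun y => iS _)
  (integrable_locally (measurable_oo a b) hf).
set F := fun x => _; apply: ae_sub => x /= [dF F'x] xD.
have <- : fab x = f x by rewrite /fab patchE mem_set.
rewrite -F'x.
have FE c d : a < c -> c < d -> d < b -> F d = F c.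
  move=> ac cd db; apply/eqP; rewrite -subr_eq0; apply/eqP.
  rewrite /F [LHS](_ : _ = \int[mu]_(t in `]c, d]) fab t); last first.
    apply: (@Rintegral_itvB R fab -oo%O (BRight d) c) ; [exact: iS|by []|by rewrite bnd_simp ltW].
  rewrite -Rintegral_itv_bndo_bndc; last exact: iS.
  rewrite -[RHS](h0 c d ac cd db) /Int Rintegral_mkcond [in RHS]Rintegral_mkcond.
  apply: eq_Rintegral => y _; rewrite /fab !patchE !mem_setE !in_itv/=.
  case: (ltP c y) => cy /=; last by rewrite mul0r; case: ifP.
  case: (ltP y d) => yd /=; last by rewrite mul0r; case: ifP.
  by rewrite mul1r.
have hx : \forall y \near x, F x = F y.
  move: xD; rewrite in_itv/= => /andP[ax xb]; near=> y.
  have ay : a < y by near: y; exact: lt_nbhsr.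
  have yb : y < b by near: y; exact: lt_nbhsl.
  by have [xy|yx|->//] := ltgtP x y; [rewrite -(FE x y)|rewrite (FE y x)].
have hE : 'D_1 (cst (F x)) x = 'D_1 F x by exact: near_eq_derive hx.
by rewrite derive1E -hE derive_cst.
Unshelve. all: by end_near. Qed.

(** Fundamental lemma of the calculus of variations: testing against the
    cut-off functions gives the integrals over all subintervals. *)
Lemma aeeqr0_test f : integ a b f ->
  (forall psi, test psi -> smooth psi -> Int a b (fun x => psi x * f x) = 0) ->
  aeeqr a b f (fun=> 0).
Proof.
by move=> hf h0; apply: aeeqr0_indic => // c d ac _ db; exact: Int_indic_cutoff.
Qed.

End Test.

(** * Weak derivatives of real functions *)
Section Weak.
Context {R : realType} (a b : R) (ab : a < b).
Implicit Types f g h F psi : R -> R.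
Notation mu := (@lebesgue_measure R).
Notation test := (@test_function R a b).

Definition has_wderiv f g : Prop := forall psi, test psi ->
  Int a b (fun x => f x * derive1 psi x) = - Int a b (fun x => g x * psi x).

Lemma integ_test f psi : integ a b f -> continuous psi ->
  integ a b (fun x => f x * psi x).
Proof.
move=> hf cp; have [M _ hM] := bounded_continuous a b cp.
have := integ_mul hf (measurable_continuous cp) hM.
by apply: eq_integ => x _; rewrite mulrC.
Qed.

Lemma Int_test_le f psi M : integ a b f -> continuous psi ->
  (forall x, x \in `]a, b[ -> `|psi x| <= M) ->
  `|Int a b (fun x => f x * psi x)| <= M * Int a b (fun x => `|f x|).
Proof.
move=> hf cp hM; rewrite (le_trans (Int_norm (integ_test hf cp)))//.
rewrite -IntZ; last exact: integ_norm.
apply: Int_le; [exact/integ_norm/integ_test|exact/integZ/integ_norm|].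
by move=> x xD; rewrite normrM mulrC ler_wpM2r// hM.
Qed.

Lemma eq0_le_eps (x : R) (C : R) : 0 <= C ->
  (forall e, 0 < e -> `|x| <= C * e) -> x = 0.
Proof.
move=> C0 h; apply/eqP; rewrite -normr_le0; apply/ler_addgt0Pr => e e0.
rewrite add0r; have e1 : 0 < e / (C + 1) by rewrite divr_gt0// ltr_wpDl.
rewrite (le_trans (h _ e1))// mulrCA ler_piMr ?(ltW e0)//.
by rewrite ler_pdivrMr ?ltr_wpDl// mul1r lerDl.
Qed.

Lemma has_wderiv_unique f g h : integ a b g -> integ a b h -> has_wderiv f g -> has_wderiv f h -> aeeqr a b g h.
Proof.
move=> hg hh wg wh.
have : aeeqr a b (fun x => g x - h x) (fun=> 0).
  apply: aeeqr0_test; first exact: integB.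
  move=> psi tp _; have cp := test_continuous tp.
  rewrite (@eq_Int _ _ _ _ (fun x => g x * psi x - h x * psi x)); last by move=> x _; ring.
  rewrite IntB; try exact: integ_test.
  by have := wg _ tp; rewrite wh// => /oppr_inj ->; rewrite subrr.
by apply: ae_sub => x hx /hx /eqP; rewrite subr_eq0 => /eqP.
Qed.

(** A test function is the derivative of a test function as soon as its
    integral is 0: its indefinite integral then vanishes on both sides of the
    support. *)
Lemma test_primitive g : test g -> smooth g -> Int a b g = 0 ->
  exists2 psi, test psi & derive1 psi = g.
Proof.
move=> tg sg g0; have [c [d [ac db cd supp]]] := test_support ab tg.
have cg := smooth_continuous sg.
have gE : g \_ `]a, b[%classic = g.
  apply/funext => x; rewrite patchE mem_setE; case: ifPn => // /(test_out tg) ->//.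
have iT : mu.-integrable setT (EFin \o g).
  rewrite -gE -restrict_EFin; apply/integrable_restrict => //=.
  by rewrite setTI; exact: integ_continuous.
have iS (i : interval R) : mu.-integrable [set` i] (EFin \o g).
  have mi : measurable ([set` i] : set (measurableTypeR R)) by exact: measurable_itv.
  by have := @integrableS _ _ _ mu _ _ _ measurableT mi (@subsetT _ _) iT.
(* integrating from -oo makes [psi] differentiable on the whole line *)
pose psi x := \int[mu]_(t in [set` Interval -oo%O (BRight x)]) g t.
have dpsi (x : R) : is_derive x 1 psi (g x).
  have xx : x < x + 1 by rewrite ltrDl.
  have xoo : (-oo%O < BRight x)%E by rewrite ltNyr.
  have [] := @continuous_FTC1 R g -oo%O x (x + 1) xx (iS _) xoo (cg x).
  by move=> dx <-; rewrite derive1E; exact: DeriveDef.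
exists psi; last exact: derive1_eq.
apply: (@test_intro _ _ _ psi c d) => //; first exact: smooth_primitive dpsi sg.
move=> x; apply: contraNT; rewrite negb_and -!ltNge => /orP[xc|dx].
  rewrite /psi (@eq_Rintegral _ _ _ _ _ (fun=> 0)); last first.
    move=> y; rewrite inE /= in_itv/= => yx; apply/eqP/contraT => /supp /andP[cy _].
    by have := le_lt_trans (le_trans cy yx) xc; rewrite ltxx.
  rewrite Rintegral_cst ?mul0r//; exact: measurable_itv.
rewrite -g0 /psi /Int Rintegral_mkcond [X in _ == X]Rintegral_mkcond; apply/eqP.
apply: eq_Rintegral => y _; rewrite !patchE !mem_setE !in_itv/=.
have [->|gy] := eqVneq (g y) 0; first by rewrite !if_same.
have /andP[cy yd] := supp _ gy.
by rewrite (le_trans yd (ltW dx)) (lt_le_trans ac cy) (le_lt_trans yd db).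
Qed.

(** The lemma of du Bois-Reymond. Any test function [eta] differs from a
    derivative of a test function by a multiple of a fixed [rho], so that [g]
    acts on [eta] as the constant [k] does. *)
Lemma has_wderiv0_const g : integ a b g -> has_wderiv g (fun=> 0) -> exists c, aeeqr a b g (fun=> c).
Proof.
move=> hg wg.
pose c := a + (b - a) / 4; pose d := b - (b - a) / 4.
have ac : a < c by rewrite /c; move: ab; lra.
have cd : c < d by rewrite /c /d; move: ab; lra.
have db : d < b by rewrite /d; move: ab; lra.
pose rho : R -> R := cutoff c d 1.
have trho : test rho by exact: cutoff_test.
have srho : smooth rho by exact: smooth_cutoff.
have crho := smooth_continuous srho.
have irho := integ_continuous a b crho.
have m0 : Int a b rho != 0.
  apply/eqP => h0; have : aeeqr a b rho (fun=> 0).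
    apply: Int_norm_eq0 => //; rewrite -[RHS]h0; apply: eq_Int => x _.
    by rewrite ger0_norm// cutoff_ge0.
  move=> /(ae_point cd) [x /[dup] cxd /andP[cx xd]].
  rewrite in_itv/= (lt_trans ac cx) (lt_trans xd db) => /(_ isT) /eqP.
  by rewrite /rho cutoffE// gt_eqF// expR_gt0.
pose k := Int a b (fun x => g x * rho x) / Int a b rho.
exists k; have : aeeqr a b (fun x => g x - k) (fun=> 0).
  apply: aeeqr0_test; first exact: integB (integ_cst _ _ _).
  move=> eta teta seta; have ceta := smooth_continuous seta.
  have ieta := integ_continuous a b ceta.
  pose m := Int a b eta / Int a b rho.
  pose h x := eta x + (- m) * rho x.
  have sh : smooth h by apply: smooth_add => //; apply: smooth_mul => //; exact: smooth_cst.
  have th : test h.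
    have [c1 [d1 [ac1 db1 cd1 supp1]]] := test_support ab teta.
    have [c2 [d2 [ac2 db2 cd2 supp2]]] := test_support ab trho.
    apply: (@test_intro _ _ _ h (Num.min c1 c2) (Num.max d1 d2)).
    - by rewrite lt_min ac1.
    - by rewrite gt_max db1.
    - exact: smooth_derivable.
    - move=> x hx; rewrite ge_min le_max.
      have [e0|/supp1/andP[-> ->]//] := eqVneq (eta x) 0.
      have [r0|/supp2/andP[-> ->]] := eqVneq (rho x) 0; last by rewrite !orbT.
      by move: hx; rewrite /h e0 r0 mulr0 addr0 eqxx.
  have h0 : Int a b h = 0 by rewrite IntD ?IntZ//; [rewrite /m mulNr divfK// subrr|exact: integZ].
  have [psi tpsi psiE] := test_primitive th sh h0.
  have := wg _ tpsi; rewrite psiE.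
  rewrite (@eq_Int _ _ _ (fun x => 0 * psi x) (fun=> 0)); last by move=> x _; rewrite mul0r.
  rewrite Int_cst ?ltW// mul0r oppr0.
  rewrite (@eq_Int _ _ _ _ (fun x => g x * eta x - m * (g x * rho x))); last by move=> x _; rewrite /h; ring.
  rewrite IntB ?IntZ; [|exact: integ_test|exact: integ_test|exact/integZ/integ_test].
  move=> /eqP; rewrite subr_eq0 => /eqP E.
  rewrite (@eq_Int _ _ _ _ (fun x => g x * eta x - k * eta x)); last by move=> x _; ring.
  rewrite IntB ?IntZ//; [|exact: integ_test|exact: integZ].
  by rewrite E /m /k; field.
by apply: ae_sub => x hx /hx /eqP; rewrite subr_eq0 => /eqP.
Qed.

Context (ha : a <= 0) (hb : 0 <= b).
Notation prim := (prim a b).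

(** True by parts when [f] is a polynomial. Both sides are continuous in [f]
    for the L^1 norm, in which the polynomials are dense. *)
Lemma has_wderiv_prim f : integ a b f -> has_wderiv (prim f) f.
Proof.
move=> hf psi tp; have cp := test_continuous tp.
have cp' := test_continuous (test_deriv ab tp).
have [M M0 hM] := bounded_continuous a b cp.
have [M' M'0 hM'] := bounded_continuous a b cp'.
apply/eqP; rewrite -addr_eq0; apply/eqP.
apply: (@eq0_le_eps _ (M' * (b - a) + M)).
  by rewrite addr_ge0// mulr_ge0// subr_ge0 ltW.
move=> e e0; have [p hp] := poly_dense ab hf e0.
have [P PE] := poly_primitive p.
have cpp : continuous (horner p) by exact: continuous_horner.
have ip := integ_continuous a b cpp.
pose g x := f x - p.[x].
have ig : integ a b g by exact: integB.
have iJg := integ_prim ig.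
have iJp := integ_prim ip.
have dF (x : R) : is_derive x 1 (fun y => P.[y] - P.[0]) p.[x].
  rewrite -[X in is_derive _ _ _ X]subr0; apply: is_deriveB.
  by rewrite -PE derivE derive1E; exact: DeriveDef.
have parts : Int a b (fun x => prim (horner p) x * derive1 psi x) =
    - Int a b (fun x => p.[x] * psi x).
  rewrite -(test_by_parts ab tp dF cpp).
  by apply: eq_Int => x xD; rewrite -PE prim_horner//; exact: subset_itv_oo_cc.
have -> : Int a b (fun x => prim f x * derive1 psi x) + Int a b (fun x => f x * psi x) =
    Int a b (fun x => prim g x * derive1 psi x) + Int a b (fun x => g x * psi x).
  rewrite (@eq_Int _ _ _ (fun x => prim f x * _) (fun x => prim g x * derive1 psi x + prim (horner p) x * derive1 psi x)); last first.
    by move=> x _; rewrite -mulrDl /g primB// subrK.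
  rewrite (@eq_Int _ _ _ (fun x => f x * _) (fun x => g x * psi x + p.[x] * psi x)); last first.
    by move=> x _; rewrite -mulrDl /g subrK.
  rewrite !IntD ?parts; try exact: integ_test.
  by rewrite addrACA addNr addr0.
rewrite (le_trans (ler_normD _ _))// mulrDl lerD//; last first.
  by rewrite (le_trans (Int_test_le ig cp hM))// ler_wpM2l.
rewrite (le_trans (Int_test_le iJg cp' hM'))// -mulrA ler_wpM2l//.
rewrite [leRHS]mulrC -Int_cst ?(ltW ab)//; apply: Int_le.
- exact: integ_norm.
- exact: integ_cst.
- by move=> x _; rewrite (le_trans (prim_norm_le _ ig)).
Qed.

(** [u] and the primitive of [w] have the same weak derivative, so that they
    differ by a constant. *)
Lemma has_wderiv_eq_prim u w : integ a b u -> integ a b w -> has_wderiv u w ->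
  exists c, aeeqr a b u (fun x => c + prim w x).
Proof.
move=> hu hw uw; have iJ := integ_prim hw.
have [|c hc] := @has_wderiv0_const (fun x => u x - prim w x) (integB hu iJ).
  move=> psi tp; have cp' := test_continuous (test_deriv ab tp).
  rewrite (@eq_Int _ _ _ _ (fun x => u x * derive1 psi x - prim w x * derive1 psi x)); last by move=> x _; ring.
  rewrite IntB; try exact: integ_test.
  rewrite uw// has_wderiv_prim// subrr (@eq_Int _ _ _ _ (fun=> 0)); last by move=> x _; rewrite mul0r.
  by rewrite Int_cst ?ltW// mul0r oppr0.
by exists c; apply: ae_sub hc => x hx /hx /eqP; rewrite subr_eq => /eqP.
Qed.

Lemma has_wderiv_cst (c : R) : has_wderiv (fun=> c) (fun=> 0).
Proof.
have dc (x : R) : is_derive x 1 (fun=> c) 0 by exact: is_derive_cst.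
by move=> psi tp; apply: (test_by_parts ab tp dc) => x; exact: cst_continuous.
Qed.

Lemma has_wderivD f f' g g' : integ a b f -> integ a b f' -> integ a b g -> integ a b g' ->
  has_wderiv f f' -> has_wderiv g g' -> has_wderiv (fun x => f x + g x) (fun x => f' x + g' x).
Proof.
move=> hf hf' hg hg' wf wg psi tp.
have cp := test_continuous tp; have cp' := test_continuous (test_deriv ab tp).
rewrite (@eq_Int _ _ _ _ (fun x => f x * derive1 psi x + g x * derive1 psi x)); last by move=> x _; ring.
rewrite (@eq_Int _ _ _ (fun x => (f' x + g' x) * _) (fun x => f' x * psi x + g' x * psi x)); last by move=> x _; ring.
by rewrite !IntD ?wf ?wg ?opprD//; exact: integ_test.
Qed.

Lemma has_wderiv_ae f f' g g' : integ a b f -> integ a b f' -> integ a b g -> integ a b g' ->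
  aeeqr a b f g -> aeeqr a b f' g' -> has_wderiv f f' -> has_wderiv g g'.
Proof.
move=> hf hf' hg hg' fg fg' wf psi tp.
have cp := test_continuous tp; have cp' := test_continuous (test_deriv ab tp).
have aeI u v k : integ a b u -> integ a b v -> continuous k -> aeeqr a b u v ->
    Int a b (fun x => u x * k x) = Int a b (fun x => v x * k x).
  move=> hu hv ck uv; apply: Int_ae; [exact: integ_measurable (integ_test hu ck)|exact: integ_measurable (integ_test hv ck)|].
  by apply: ae_sub uv => x hx /hx ->.
by rewrite -(aeI _ _ _ hf hg cp' fg) -(aeI _ _ _ hf' hg' cp fg') wf.
Qed.

(** [f x = o(x)] at 0, within ]a, b[; the point 0 may be an endpoint. *)
Definition little_at0 f := forall e, 0 < e ->
  exists2 d, 0 < d & forall x, x \in `]a, b[ -> `|x| < d -> `|f x| <= e * `|x|.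

(** As 0 may be an endpoint, the point is sought on the side of 0 where ]a, b[
    has room. *)
Lemma ae_point0 (P : R -> Prop) d : 0 < d -> {ae mu, forall x, P x} ->
  exists x, [/\ x \in `]a, b[, x != 0, `|x| < d & P x].
Proof.
move=> d0 hP; have [b0|b0] := ltP 0 b.
  have h : 0 < Num.min b d by rewrite lt_min b0.
  have [x /andP[x0]] := ae_point h hP; rewrite lt_min => /andP[xb xd] Px.
  by exists x; rewrite in_itv/= (le_lt_trans ha x0) xb gt_eqF// gtr0_norm.
have a0 : a < 0 by rewrite (lt_le_trans ab).
have h : Num.max a (- d) < 0 by rewrite gt_max a0 oppr_lt0.
have [x /andP[+ x0]] := ae_point h hP; rewrite gt_max => /andP[ax xd] Px.
exists x; rewrite in_itv/= ax (lt_le_trans x0 hb) lt_eqF// ltr0_norm//.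
by rewrite ltrNl.
Qed.

(** An affine function that is [o(x)] along some sequence tending to 0 is zero;
    such a sequence is found in the set of full measure where the equation
    holds. *)
Lemma affine_little_at0 (c0 c1 : R) f g : little_at0 f -> little_at0 g ->
  aeeqr a b (fun x => c0 + c1 * x + f x) g -> c0 = 0 /\ c1 = 0.
Proof.
move=> ff fg h.
have key e : 0 < e -> exists2 d0, 0 < d0 & forall d, 0 < d -> exists x, [/\ x != 0, `|x| < Num.min d d0 & `|c0 + c1 * x| <= e * `|x|].
  move=> e0; have e2 : 0 < e / 2 by rewrite divr_gt0.
  have [d1 d10 h1] := ff _ e2; have [d2 d20 h2] := fg _ e2.
  exists (Num.min d1 d2); first by rewrite lt_min d10.
  move=> d d0; have dd : 0 < Num.min d (Num.min d1 d2) by rewrite !lt_min d0 d10.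
  have [x [xD x0 xd hx]] := ae_point0 dd h.
  exists x; split=> //.
  move: xd; rewrite !lt_min => /and3P[_ xd1 xd2].
  rewrite (_ : c0 + c1 * x = g x - f x); last by rewrite -hx//; ring.
  rewrite (le_trans (ler_normB _ _))// (splitr e) mulrDl addrC lerD ?h1 ?h2//.
have c00 : c0 = 0.
  have [d0 d00 hd] := key 1 ltr01.
  apply: (@eq0_le_eps _ (1 + `|c1|)); first by rewrite addr_ge0.
  move=> e e0; have [x [x0 xd hx]] := hd _ e0.
  have {xd} xd : `|x| < e by move: xd; rewrite lt_min => /andP[].
  rewrite mul1r in hx.
  rewrite -(addrK (c1 * x) c0) (le_trans (ler_normB _ _))// normrM.
  rewrite mulrDl mul1r lerD//; first by rewrite (le_trans hx)// ltW.
  by rewrite ler_wpM2l// ltW.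
split=> //; apply: (@eq0_le_eps _ 1) => // e e0.
have [d0 d00 hd] := key _ e0; have [x [x0 _ hx]] := hd _ d00.
by move: hx; rewrite c00 add0r normrM mul1r ler_pM2r// normr_gt0.
Qed.

(** Mean value theorem between 0 and [x]. *)
Lemma C1_little_at0 f f1 : C1_real a b f f1 -> f 0 = 0 -> f1 0 = 0 -> little_at0 f.
Proof.
move=> [cf cf1 df] f0 f10 e e0.
have ab0 : (0 : R) \in `[a, b] by rewrite in_itv/= ha hb.
have [d /= d0 hd] : exists2 d, 0 < d & forall y, y \in `[a, b] -> `|y| < d -> `|f1 y| <= e.
  move/subspace_continuousP : cf1 => /(_ 0 ab0).
  move=> /cvgrPdist_le /(_ _ e0) [d /= d0 hd].
  exists d => // y yab yd; rewrite -normrN -sub0r -f10; apply: hd => //=.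
  by rewrite /ball_/= sub0r normrN.
exists d => // x xD xd; move: (xD); rewrite in_itv/= => /andP[ax xb].
have [x0|x0|->] := ltgtP x 0; last by rewrite f0 !normr0 mulr0.
- have df' (z : R) : z \in `]x, 0[ -> is_derive z 1 f (f1 z).
    rewrite in_itv/= => /andP[xz z0]; apply: df.
    by rewrite in_itv/= (lt_trans ax xz) (lt_le_trans z0).
  have cf' : {within `[x, 0], continuous f}.
    apply: continuous_subspaceW cf => z /=; rewrite !in_itv/= => /andP[xz z0].
    by rewrite (le_trans (ltW ax) xz) (le_trans z0).
  have [c cx] := MVT x0 df' cf'.
  move: cx; rewrite in_itv/= => /andP[xc c0]; rewrite f0 !sub0r => E.
  rewrite -normrN E normrM normrN ler_wpM2r// hd//.
    by rewrite in_itv/= (ltW (lt_trans ax xc)) (le_trans (ltW c0)).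
  by rewrite (lt_trans _ xd)// !ltr0_norm// ltrN2.
- have df' (z : R) : z \in `]0, x[ -> is_derive z 1 f (f1 z).
    rewrite in_itv/= => /andP[xz z0]; apply: df.
    by rewrite in_itv/= (le_lt_trans ha xz) (lt_trans z0).
  have cf' : {within `[0, x], continuous f}.
    apply: continuous_subspaceW cf => z /=; rewrite !in_itv/= => /andP[xz z0].
    by rewrite (le_trans ha xz) (le_trans z0)// ltW.
  have [c cx] := MVT x0 df' cf'.
  move: cx; rewrite in_itv/= => /andP[xc c0]; rewrite f0 !subr0 => E.
  rewrite E normrM ler_wpM2r// hd//.
    by rewrite in_itv/= (le_trans ha (ltW xc)) (ltW (lt_trans c0 xb)).
  by rewrite (lt_trans _ xd)// !gtr0_norm.
Qed.

Lemma prim2_little_at0 w : integ a b w -> little_at0 (prim (prim w)).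
Proof.
move=> hw e e0; have [d d0 hd] := prim_small ha hb ab hw e0.
exists d => // x xD xd; apply: prim_near_bound => //; first exact: integ_prim.
  exact: subset_itv_oo_cc.
move=> y yD yx; apply: hd; first exact: subset_itv_oo_cc.
exact: le_lt_trans yx xd.
Qed.

End Weak.

(** * Complex valued integrable functions *)
Section ComplexBasics.
Local Open Scope complex_scope.
Context {R : realType}.
Implicit Types z w : R[i].
Notation Re := complex.Re.
Notation Im := complex.Im.

Lemma complex_ext z w : Re z = Re w -> Im z = Im w -> z = w.
Proof. by case: z => ? ?; case: w => ? ? /= -> ->. Qed.
Lemma cReD z w : Re (z + w) = Re z + Re w. Proof. by case: z; case: w. Qed.
Lemma cImD z w : Im (z + w) = Im z + Im w. Proof. by case: z; case: w. Qed.
Lemma cReN z : Re (- z) = - Re z. Proof. by case: z. Qed.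
Lemma cImN z : Im (- z) = - Im z. Proof. by case: z. Qed.
Lemma cReM z w : Re (z * w) = Re z * Re w - Im z * Im w.
Proof. by case: z => ? ?; case: w => ? ?. Qed.
Lemma cImM z w : Im (z * w) = Re z * Im w + Im z * Re w.
Proof. by case: z => ? ?; case: w => ? ?. Qed.
Lemma cRe_real (r : R) : Re r%:C = r. Proof. by []. Qed.
Lemma cIm_real (r : R) : Im r%:C = 0. Proof. by []. Qed.
Lemma cRe_mk (x y : R) : Re (x +i* y) = x. Proof. by []. Qed.
Lemma cIm_mk (x y : R) : Im (x +i* y) = y. Proof. by []. Qed.
Lemma cRe_0 : Re (0 : R[i]) = 0. Proof. by []. Qed.
Lemma cIm_0 : Im (0 : R[i]) = 0. Proof. by []. Qed.
Lemma cRe_1 : Re (1 : R[i]) = 1. Proof. by []. Qed.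
Lemma cIm_1 : Im (1 : R[i]) = 0. Proof. by []. Qed.

Definition cE := (cReD, cImD, cReN, cImN, cReM, cImM, cRe_real, cIm_real, cRe_mk, cIm_mk,
  (cRe_0, cIm_0, cRe_1, cIm_1)).

(** The l^1 norm on R^2 is equivalent to the modulus, submultiplicative, and
    its integral splits into those of real and imaginary parts. *)
Definition norm1 z : R := `|Re z| + `|Im z|.

Lemma norm1_ge0 z : 0 <= norm1 z. Proof. by rewrite addr_ge0. Qed.
Lemma norm1D z w : norm1 (z + w) <= norm1 z + norm1 w.
Proof. by rewrite /norm1 !cE addrACA lerD// ler_normD. Qed.
Lemma norm1N z : norm1 (- z) = norm1 z.
Proof. by rewrite /norm1 !cE !normrN. Qed.
Lemma norm1B z w : norm1 (z - w) <= norm1 z + norm1 w.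
Proof. by rewrite -[norm1 w]norm1N norm1D. Qed.
Lemma norm1M z w : norm1 (z * w) <= norm1 z * norm1 w.
Proof.
rewrite /norm1 !cE (le_trans (lerD (ler_normB _ _) (ler_normD _ _)))// !normrM.
by rewrite le_eqVlt; apply/orP; left; apply/eqP; ring.
Qed.
Lemma norm1_eq0 z : norm1 z <= 0 -> z = 0.
Proof.
move=> h; have h1 : `|Re z| <= 0 by rewrite (le_trans _ h)// lerDl.
have h2 : `|Im z| <= 0 by rewrite (le_trans _ h)// lerDr.
by apply: complex_ext; apply/eqP; rewrite -normr_le0.
Qed.

Lemma Re_normE z : Re `|z| = Num.sqrt (Re z ^+ 2 + Im z ^+ 2).
Proof. by case: z. Qed.

Lemma Re_norm_le z : Re `|z| <= norm1 z.
Proof.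
rewrite Re_normE -[leRHS]ger0_norm ?norm1_ge0// -sqrtr_sqr ler_wsqrtr//.
rewrite /norm1 sqrrD !real_normK ?num_real// lerD2r lerDl mulrn_wge0//.
Qed.

Lemma norm1_le_norm z : norm1 z <= 2 * Re `|z|.
Proof.
rewrite Re_normE mulr2n mulrDl mul1r /norm1 lerD//.
  by rewrite -sqrtr_sqr ler_wsqrtr// lerDl sqr_ge0.
by rewrite -sqrtr_sqr ler_wsqrtr// lerDr sqr_ge0.
Qed.

End ComplexBasics.

Section ComplexL1.
Local Open Scope complex_scope.
Context {R : realType} (a b : R) (ab : a < b) (ha : a <= 0) (hb : 0 <= b).
Implicit Types u v w q : R -> R[i].
Notation Re := complex.Re.
Notation Im := complex.Im.
Notation L1 := (L1 a b).
Notation aeeq := (aeeq a b).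
Notation mu := (@lebesgue_measure R).

Definition cmeasurable u := measurable_fun `]a, b[ (fun x => Re (u x)) /\
  measurable_fun `]a, b[ (fun x => Im (u x)).

Definition normL1 u : R := Int a b (fun x => norm1 (u x)).

Lemma L1_cmeasurable u : L1 u -> cmeasurable u.
Proof. by move=> [h1 h2]; split; [exact: integ_measurable h1|exact: integ_measurable h2]. Qed.

Lemma L1_mk u : integ a b (fun x => Re (u x)) -> integ a b (fun x => Im (u x)) -> L1 u.
Proof. by []. Qed.

Lemma eq_L1 u v : (forall x, x \in `]a, b[ -> u x = v x) -> L1 u -> L1 v.
Proof.
by move=> uv [h1 h2]; split; [apply: eq_integ h1|apply: eq_integ h2] => x /uv ->.
Qed.

Lemma L1D u v : L1 u -> L1 v -> L1 (fun x => u x + v x).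
Proof.
move=> [u1 u2] [v1 v2]; apply: L1_mk.
  by apply: (eq_integ _ (integD u1 v1)) => x _; rewrite cReD.
by apply: (eq_integ _ (integD u2 v2)) => x _; rewrite cImD.
Qed.

Lemma L1Z (c : R[i]) u : L1 u -> L1 (fun x => c * u x).
Proof.
move=> [u1 u2]; apply: L1_mk.
  by apply: (eq_integ _ (integB (integZ (Re c) u1) (integZ (Im c) u2))) => x _; rewrite cReM.
by apply: (eq_integ _ (integD (integZ (Re c) u2) (integZ (Im c) u1))) => x _; rewrite cImM.
Qed.

Lemma L1B u v : L1 u -> L1 v -> L1 (fun x => u x - v x).
Proof.
move=> hu /(L1Z (-1)) hv; apply: eq_L1 (L1D hu hv) => x _.
by rewrite mulN1r.
Qed.

Lemma L1_cst (c : R[i]) : L1 (fun=> c).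
Proof. by apply: L1_mk; exact: integ_cst. Qed.

Lemma cmeasurableM u v : cmeasurable u -> cmeasurable v -> cmeasurable (fun x => u x * v x).
Proof.
move=> [u1 u2] [v1 v2]; split.
  rewrite [X in measurable_fun _ X](_ : _ = fun x => Re (u x) * Re (v x) - Im (u x) * Im (v x)).
    by apply: measurable_funB; exact: measurable_funM.
  by apply/funext => x; rewrite cReM.
rewrite [X in measurable_fun _ X](_ : _ = fun x => Re (u x) * Im (v x) + Im (u x) * Re (v x)).
  by apply: measurable_funD; exact: measurable_funM.
by apply/funext => x; rewrite cImM.
Qed.

Lemma cmeasurableB u v : cmeasurable u -> cmeasurable v -> cmeasurable (fun x => u x - v x).
Proof.
move=> [u1 u2] [v1 v2]; split.
  rewrite [X in measurable_fun _ X](_ : _ = fun x => Re (u x) - Re (v x)).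
    exact: measurable_funB.
  by apply/funext => x; rewrite cReD cReN.
rewrite [X in measurable_fun _ X](_ : _ = fun x => Im (u x) - Im (v x)).
  exact: measurable_funB.
by apply/funext => x; rewrite cImD cImN.
Qed.

Lemma measurable_norm1 u : cmeasurable u -> measurable_fun `]a, b[ (fun x => norm1 (u x)).
Proof. by move=> [u1 u2]; apply: measurable_funD; apply: measurableT_comp. Qed.

Lemma integ_norm1 u : L1 u -> integ a b (fun x => norm1 (u x)).
Proof. by move=> [u1 u2]; apply: integD; exact: integ_norm. Qed.

Lemma L1_le u g : cmeasurable u -> integ a b g ->
  (forall x, x \in `]a, b[ -> norm1 (u x) <= g x) -> L1 u.
Proof.
move=> [m1 m2] hg h; split; (apply: (integ_le _ _ hg); first by []);
  by move=> x xD; rewrite (le_trans _ (h x xD))// ?lerDl ?lerDr.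
Qed.

Lemma L1_mul q u (M : R) : L1 q -> cmeasurable u ->
  (forall x, x \in `]a, b[ -> norm1 (u x) <= M) -> L1 (fun x => q x * u x).
Proof.
move=> hq mu hM; apply: (@L1_le _ (fun x => M * norm1 (q x))).
- by apply: cmeasurableM => //; exact: L1_cmeasurable.
- exact/integZ/integ_norm1.
- by move=> x xD; rewrite (le_trans (norm1M _ _))// mulrC ler_wpM2r ?norm1_ge0// hM.
Qed.

Lemma normL1_ge0 u : 0 <= normL1 u.
Proof. by apply: Int_ge0 => x _; exact: norm1_ge0. Qed.

Lemma normL1_le u g : L1 u -> integ a b g -> (forall x, x \in `]a, b[ -> norm1 (u x) <= g x) ->
  normL1 u <= Int a b g.
Proof. by move=> hu hg h; apply: Int_le => //; exact: integ_norm1. Qed.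

Lemma normL1D u v : L1 u -> L1 v -> normL1 (fun x => u x + v x) <= normL1 u + normL1 v.
Proof.
move=> hu hv; rewrite /normL1 -IntD; try exact: integ_norm1.
by apply: Int_le => [||x _]; [exact/integ_norm1/L1D|exact: integD (integ_norm1 hu) (integ_norm1 hv)|exact: norm1D].
Qed.

Lemma normL1B u v : L1 u -> L1 v -> normL1 (fun x => u x - v x) <= normL1 u + normL1 v.
Proof.
move=> hu hv; rewrite /normL1 -IntD; try exact: integ_norm1.
by apply: Int_le => [||x _]; [exact/integ_norm1/L1B|exact: integD (integ_norm1 hu) (integ_norm1 hv)|exact: norm1B].
Qed.

Lemma eq_normL1 u v : (forall x, x \in `]a, b[ -> norm1 (u x) = norm1 (v x)) -> normL1 u = normL1 v.
Proof. exact: eq_Int. Qed.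

Lemma normL1_ae u v : L1 u -> L1 v -> aeeq u v -> normL1 u = normL1 v.
Proof.
move=> hu hv uv; apply: Int_ae; try exact/integ_measurable/integ_norm1.
- exact: measurable_norm1 (L1_cmeasurable hu).
- exact: measurable_norm1 (L1_cmeasurable hv).
- by apply: ae_sub uv => x h xD; rewrite h.
Qed.

Lemma normL1_eq0 u : L1 u -> normL1 u = 0 -> aeeq u (fun=> 0).
Proof.
move=> hu h0; have : aeeqr a b (fun x => norm1 (u x)) (fun=> 0).
  apply: Int_norm_eq0; first exact: integ_norm1.
  by rewrite -[RHS]h0; apply: eq_Int => x _; rewrite ger0_norm ?norm1_ge0.
by apply: ae_sub => x h xD; apply: norm1_eq0; rewrite h.
Qed.

Lemma integ_L1norm u : L1 u -> integ a b (fun x => Re `|u x|).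
Proof.
move=> hu; apply: (integ_le _ _ (integ_norm1 hu)).
  rewrite [X in measurable_fun _ X](_ : _ = fun x => Num.sqrt (Re (u x) ^+ 2 + Im (u x) ^+ 2)); last first.
    by apply/funext => x; rewrite Re_normE.
  have [m1 m2] := L1_cmeasurable hu.
  have ms : measurable_fun setT (@Num.sqrt R).
    by apply: continuous_measurable_fun; exact: sqrt_continuous.
  apply: (measurableT_comp ms).
  by apply: measurable_funD; exact: measurable_funX.
by move=> x _; rewrite ger0_norm ?Re_norm_le// Re_normE sqrtr_ge0.
Qed.

Lemma L1norm_le_normL1 u : L1 u -> L1norm a b u <= normL1 u.
Proof.
move=> hu; apply: Int_le; [exact: integ_L1norm|exact: integ_norm1|].
by move=> x _; exact: Re_norm_le.
Qed.

Lemma normL1_le_L1norm u : L1 u -> normL1 u <= 2 * L1norm a b u.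
Proof.
move=> hu; rewrite -[L1norm _ _ _]/(Int a b (fun x => Re `|u x|)) -IntZ; last exact: integ_L1norm.
apply: Int_le; [exact: integ_norm1|exact/integZ/integ_L1norm|].
by move=> x _; exact: norm1_le_norm.
Qed.

Lemma L1norm_ge0 u : 0 <= L1norm a b u.
Proof. by apply: Int_ge0 => x _; rewrite Re_normE sqrtr_ge0. Qed.

Lemma aeeq_refl u : aeeq u u. Proof. exact: ae_all. Qed.
Lemma aeeq_sym u v : aeeq u v -> aeeq v u.
Proof. by apply: ae_sub => x h xD; rewrite h. Qed.
Lemma aeeq_trans v u w : aeeq u v -> aeeq v w -> aeeq u w.
Proof. by move=> h1 h2; apply: ae_sub (ae_and h1 h2) => x [h3 h4] xD; rewrite h3 ?h4. Qed.
Lemma aeeq_eq u v : (forall x, x \in `]a, b[ -> u x = v x) -> aeeq u v.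
Proof. by move=> h; exact: ae_all. Qed.
Lemma aeeqD u u' v v' : aeeq u u' -> aeeq v v' ->
  aeeq (fun x => u x + v x) (fun x => u' x + v' x).
Proof. by move=> h1 h2; apply: ae_sub (ae_and h1 h2) => x [h3 h4] xD; rewrite h3 ?h4. Qed.
Lemma aeeqZ c u u' : aeeq u u' -> aeeq (fun x => c * u x) (fun x => c * u' x).
Proof. by apply: ae_sub => x h xD; rewrite h. Qed.
Lemma aeeqM q u u' : aeeq u u' -> aeeq (fun x => q x * u x) (fun x => q x * u' x).
Proof. by apply: ae_sub => x h xD; rewrite h. Qed.

(** Measurability of [v] cannot be deduced from that of [u]: functions are Borel
    and the measure is not complete. *)
Lemma L1_ae u v : aeeq u v -> cmeasurable v -> L1 u -> L1 v.
Proof.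
move=> uv [m1 m2] [[h1 h2]]; have measurable_oo' := measurable_oo a b.
have aux (f g : R -> R) : aeeqr a b f g -> measurable_fun `]a, b[ g -> integ a b f -> integ a b g.
  move=> fg mg /integrableP[mf fi]; apply/integrableP; split; first exact/measurable_EFinP.
  rewrite (le_lt_trans _ fi)// le_eqVlt; apply/orP; left; apply/eqP.
  apply: ae_eq_integral => //.
  - apply: measurableT_comp => //; exact/measurable_EFinP.
  - exact: measurableT_comp.
  - by apply: ae_sub fg => x h xD /=; rewrite h.
split; [apply: aux h1 => //|apply: aux h2 => //].
- by apply: ae_sub uv => x h xD; rewrite h.
- by apply: ae_sub uv => x h xD; rewrite h.
Qed.

Definition cprim u x : R[i] := prim a b (fun y => Re (u y)) x +i* prim a b (fun y => Im (u y)) x.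

Lemma eq_cprim u v x : (forall y, y \in `]a, b[ -> u y = v y) -> cprim u x = cprim v x.
Proof. by move=> uv; congr (_ +i* _); apply: eq_prim => y /uv ->. Qed.

Lemma cprim_ae u v x : L1 u -> L1 v -> aeeq u v -> cprim u x = cprim v x.
Proof.
move=> /L1_cmeasurable[m1 m2] /L1_cmeasurable[m3 m4] uv.
by congr (_ +i* _); apply: prim_ae => //; apply: ae_sub uv => y h yD; rewrite h.
Qed.

Lemma cprimD u v x : L1 u -> L1 v -> cprim (fun y => u y + v y) x = cprim u x + cprim v x.
Proof.
move=> [u1 u2] [v1 v2]; apply: complex_ext; rewrite !cE -primD//.
  by apply: eq_prim => y _; rewrite !cE.
by apply: eq_prim => y _; rewrite !cE.
Qed.

Lemma cprimZ c u x : L1 u -> cprim (fun y => c * u y) x = c * cprim u x.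
Proof.
move=> [u1 u2]; apply: complex_ext; rewrite !cE -!primZ//.
  rewrite -primB; try exact: integZ.
  by apply: eq_prim => y _; rewrite !cE.
rewrite -primD; try exact: integZ.
by apply: eq_prim => y _; rewrite !cE.
Qed.

Lemma cprimB u v x : L1 u -> L1 v -> cprim (fun y => u y - v y) x = cprim u x - cprim v x.
Proof.
move=> hu hv; rewrite -mulN1r -cprimZ// -cprimD//; last exact: L1Z.
by apply: eq_cprim => y _; rewrite mulN1r.
Qed.

Lemma L1_cprim u : L1 u -> L1 (cprim u).
Proof. by move=> [u1 u2]; split; exact: integ_prim. Qed.

Lemma cprim_norm_ker u x : L1 u -> norm1 (cprim u x) <= Int a b (fun y => `|ker x y| * norm1 (u y)).
Proof.
move=> [u1 u2].
rewrite (@eq_Int _ _ _ _ (fun y => `|ker x y| * `|Re (u y)| + `|ker x y| * `|Im (u y)|)); last first.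
  by move=> y _; rewrite mulrDr.
by rewrite IntD ?lerD ?prim_norm_ker//; exact/integ_normr_ker/integ_norm.
Qed.

Lemma cprim_norm_le u x : L1 u -> norm1 (cprim u x) <= normL1 u.
Proof.
move=> hu; rewrite (le_trans (cprim_norm_ker _ hu))//; apply: Int_le.
- exact/integ_normr_ker/integ_norm1.
- exact: integ_norm1.
- by move=> y _; rewrite ler_piMl ?norm1_ge0// ker_norm.
Qed.

(** If [y] lies between 0 and [x], so does everything between 0 and [y]. *)
Lemma ker_mono (x y z : R) : ker x y != 0 -> `|ker y z| <= `|ker x z|.
Proof.
rewrite /ker; case: (ltP y x) => yx; case: (ltP y 0) => y0; rewrite ?subrr ?eqxx// => _.
  case: (ltP z 0) => z0.
    by rewrite (lt_le_trans z0 y0) subrr normr0.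
  case: (ltP z y) => zy; last by rewrite subrr normr0.
  by rewrite (lt_trans zy yx).
case: (ltP z 0) => z0; last first.
  by rewrite ltNge (le_trans (ltW y0) z0) /= subrr normr0.
case: (ltP z y) => zy; first by rewrite subrr normr0.
by rewrite ltNge (le_trans yx zy).
Qed.

(** Keeping the kernel on the right hand side, and not only the norm of [u], is
    what allows Gronwall's inequality to be applied to an integral equation with
    two primitives. *)
Lemma cprim2_norm_ker u x : L1 u -> x \in `]a, b[ ->
  norm1 (cprim (cprim u) x) <= (b - a) * Int a b (fun y => `|ker x y| * norm1 (u y)).
Proof.
move=> hu xD; rewrite (le_trans (cprim_norm_ker _ (L1_cprim hu)))//.
set I := (X in _ <= _ * X); have I0 : 0 <= I.
  by apply: Int_ge0 => y _; rewrite mulr_ge0 ?norm1_ge0.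
rewrite [leRHS]mulrC -Int_cst ?(ltW ab)//; apply: Int_le.
- exact/integ_normr_ker/integ_norm1/L1_cprim.
- exact: integ_cst.
- move=> y yD; have [->|k0] := eqVneq (ker x y) 0.
    by rewrite normr0 mul0r.
  rewrite (@le_trans _ _ (norm1 (cprim u y)))//; first by rewrite ler_piMl ?norm1_ge0// ker_norm.
  rewrite (le_trans (cprim_norm_ker _ hu))//; apply: Int_le.
  + exact/integ_normr_ker/integ_norm1.
  + exact/integ_normr_ker/integ_norm1.
  + by move=> z _; rewrite ler_wpM2r ?norm1_ge0// ker_mono.
Qed.

Lemma cprim2_norm_le u x : L1 u -> x \in `]a, b[ -> norm1 (cprim (cprim u) x) <= (b - a) * normL1 u.
Proof.
move=> hu xD; rewrite (le_trans (cprim2_norm_ker hu xD))// ler_wpM2l ?subr_ge0 ?(ltW ab)//.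
apply: Int_le.
- exact/integ_normr_ker/integ_norm1.
- exact: integ_norm1.
- by move=> y _; rewrite ler_piMl ?norm1_ge0// ker_norm.
Qed.

Lemma normL1_cprim2 u : L1 u -> normL1 (cprim (cprim u)) <= (b - a) * normL1 u * (b - a).
Proof.
move=> hu; rewrite -Int_cst ?(ltW ab)//; apply: normL1_le.
- exact/L1_cprim/L1_cprim.
- exact: integ_cst.
- by move=> x xD; exact: cprim2_norm_le.
Qed.

Lemma cprim1 x : x \in `[a, b] -> cprim (fun=> 1) x = x%:C.
Proof.
move=> xab; rewrite /cprim; apply: complex_ext; rewrite !cE.
  have d1 (y : R) : is_derive y 1 (fun z : R => z) 1 by exact: is_derive_id.
  rewrite -[LHS]/(prim a b (fun=> 1) x) (prim_deriv ha hb d1) ?subr0//.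
  exact: cst_continuous.
rewrite /prim (@eq_Int _ _ _ _ (fun=> 0)) ?Int_cst ?mul0r ?(ltW ab)// => y _.
by rewrite mulr0.
Qed.

End ComplexL1.

(** * Sobolev functions and the equation u'' - q u = f *)
Section Sobolev.
Local Open Scope complex_scope.
Context {R : realType} (a b : R) (ab : a < b) (ha : a <= 0) (hb : 0 <= b).
Implicit Types u v w q f g : R -> R[i].
Notation Re := complex.Re.
Notation Im := complex.Im.
Notation L1 := (L1 a b).
Notation aeeq := (aeeq a b).
Notation cprim := (cprim a b).
Notation test := (@test_function R a b).
Notation weakd := (weak_derivative a b).

Lemma cint_mulC u (k : R -> R) : cintegral a b (fun x => u x * (k x)%:C) =
  Int a b (fun x => Re (u x) * k x) +i* Int a b (fun x => Im (u x) * k x).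
Proof.
congr (_ +i* _); apply: eq_Int => x _; rewrite !cE; ring.
Qed.

Lemma eq_cint u v : (forall x, x \in `]a, b[ -> u x = v x) ->
  cintegral a b u = cintegral a b v.
Proof. by move=> uv; congr (_ +i* _); apply: eq_Int => x /uv ->. Qed.

Lemma cintD u v : L1 u -> L1 v ->
  cintegral a b (fun x => u x + v x) = cintegral a b u + cintegral a b v.
Proof.
move=> [u1 u2] [v1 v2]; apply: complex_ext; rewrite !cE.
  by rewrite -[LHS]/(Int a b _) -IntD//; apply: eq_Int => x _; rewrite cE.
by rewrite -[LHS]/(Int a b _) -IntD//; apply: eq_Int => x _; rewrite cImD.
Qed.

Lemma cintB u v : L1 u -> L1 v ->
  cintegral a b (fun x => u x - v x) = cintegral a b u - cintegral a b v.
Proof.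
move=> [u1 u2] [v1 v2]; apply: complex_ext; rewrite !cE.
  by rewrite -[LHS]/(Int a b _) -IntB//; apply: eq_Int => x _; rewrite !cE.
by rewrite -[LHS]/(Int a b _) -IntB//; apply: eq_Int => x _; rewrite !cE.
Qed.

Lemma L1_test u (psi : R -> R) : L1 u -> continuous psi -> L1 (fun x => u x * (psi x)%:C).
Proof.
move=> [u1 u2] cp; apply: L1_mk.
  by apply: (eq_integ _ (integ_test u1 cp)) => x _; rewrite !cE; ring.
by apply: (eq_integ _ (integ_test u2 cp)) => x _; rewrite !cE; ring.
Qed.

Lemma weakd1P u v : weakd 1 u v <->
  has_wderiv a b (fun x => Re (u x)) (fun x => Re (v x)) /\
  has_wderiv a b (fun x => Im (u x)) (fun x => Im (v x)).
Proof.
split=> [h|[h1 h2] psi tp].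
  by split=> psi tp; have := h psi tp; rewrite !cint_mulC expr1 mulN1r => -[].
rewrite !cint_mulC expr1 mulN1r; apply: complex_ext; rewrite ?cReN ?cImN.
  exact: h1.
exact: h2.
Qed.

Lemma weakd_comp u v w : weakd 1 u v -> weakd 1 v w -> weakd 2 u w.
Proof.
move=> uv vw psi tp; have tp' := test_deriv ab tp.
have := uv _ tp'; have := vw _ tp; rewrite !expr1 !mulN1r => h1 h2.
by rewrite sqrrN expr1n mul1r -[LHS]/(cintegral a b (fun x => u x * (derive1n 1 (derive1 psi) x)%:C)) h2 h1 opprK.
Qed.

(** Derivatives of test functions are test functions. *)
Lemma weakd_step u v w : weakd 1 u v -> weakd 2 u w -> weakd 1 v w.
Proof.
move=> uv uw psi tp; have tp' := test_deriv ab tp.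
have := uv _ tp'; have := uw _ tp; rewrite sqrrN expr1n !expr1 !mulN1r mul1r => h1 h2.
by rewrite -h1 -[X in - X]/(cintegral a b (fun x => u x * (derive1n 1 (derive1 psi) x)%:C)) h2 opprK.
Qed.

Lemma weakd0 u : weakd 0 u u.
Proof. by move=> psi _; rewrite expr0 mul1r. Qed.

Lemma weakd1_primitive u v : L1 u -> L1 v -> weakd 1 u v ->
  exists c, aeeq u (fun x => c + cprim v x).
Proof.
move=> [u1 u2] [v1 v2] /weakd1P[h1 h2].
have [c1 hc1] := has_wderiv_eq_prim ab ha hb u1 v1 h1.
have [c2 hc2] := has_wderiv_eq_prim ab ha hb u2 v2 h2.
exists (c1 +i* c2); apply: ae_sub (ae_and hc1 hc2) => x [k1 k2] xD.
by apply: complex_ext; rewrite ?cReD ?cImD /= ?k1 ?k2.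
Qed.

Lemma primitive_weakd1 u v c : L1 u -> L1 v -> aeeq u (fun x => c + cprim v x) ->
  weakd 1 u v.
Proof.
move=> [u1 u2] hv h; have [v1 v2] := hv; apply/weakd1P; split.
  apply: (@has_wderiv_ae _ a b ab (fun x => Re c + prim a b (fun y => Re (v y)) x) (fun x => 0 + Re (v x))) => //.
  - exact: integD (integ_cst _ _ _) (integ_prim v1).
  - exact: integD (integ_cst _ _ _) v1.
  - by apply: ae_sub h => x h xD; rewrite h// !cE.
  - by apply: ae_all => x _; rewrite add0r.
  - by apply: has_wderivD => //; [exact: integ_cst|exact: integ_cst|exact: integ_prim|exact: has_wderiv_cst|exact: has_wderiv_prim].
apply: (@has_wderiv_ae _ a b ab (fun x => Im c + prim a b (fun y => Im (v y)) x) (fun x => 0 + Im (v x))) => //.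
- exact: integD (integ_cst _ _ _) (integ_prim v2).
- exact: integD (integ_cst _ _ _) v2.
- by apply: ae_sub h => x h xD; rewrite h// !cE.
- by apply: ae_all => x _; rewrite add0r.
- by apply: has_wderivD => //; [exact: integ_cst|exact: integ_cst|exact: integ_prim|exact: has_wderiv_cst|exact: has_wderiv_prim].
Qed.

(** Taylor's formula at 0 with integral remainder; it holds for some [c0] and
    [c1] exactly when [w] is the second weak derivative of [u]. *)
Definition taylor u (c0 c1 : R[i]) w : Prop :=
  aeeq u (fun x => c0 + c1 * x%:C + cprim (cprim w) x).

Lemma cprim_affine (c : R[i]) w x : L1 w -> x \in `]a, b[ ->
  cprim (fun y => c + cprim w y) x = c * x%:C + cprim (cprim w) x.
Proof.
move=> hw xD; rewrite cprimD; [|exact: L1_cst|exact: L1_cprim]; congr (_ + _).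
rewrite -(cprim1 ab ha hb (subset_itv_oo_cc xD)) -cprimZ; last exact: L1_cst.
by apply: eq_cprim => y _; rewrite mulr1.
Qed.

Lemma weakd_taylor u v w : L1 u -> L1 v -> L1 w -> weakd 1 u v -> weakd 1 v w ->
  exists c0 c1, taylor u c0 c1 w.
Proof.
move=> hu hv hw uv vw.
have [c1 h1] := weakd1_primitive hv hw vw.
have [c0 h0] := weakd1_primitive hu hv uv.
exists c0, c1; apply: aeeq_trans h0 _; apply: aeeq_eq => x xD.
rewrite -addrA -cprim_affine//; congr (_ + _); apply: cprim_ae => //.
exact: L1D (L1_cst _ _ _) (L1_cprim hw).
Qed.

Lemma taylor_weakd u w c0 c1 : L1 u -> L1 w -> taylor u c0 c1 w ->
  weakd 1 u (fun x => c1 + cprim w x) /\ weakd 1 (fun x => c1 + cprim w x) w.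
Proof.
move=> hu hw h; have hv : L1 (fun x => c1 + cprim w x) by exact: L1D (L1_cst _ _ _) (L1_cprim hw).
split; last by apply: (@primitive_weakd1 _ _ c1) => //; exact: aeeq_refl.
apply: (@primitive_weakd1 _ _ c0) => //; apply: aeeq_trans h _.
by apply: aeeq_eq => x xD; rewrite cprim_affine// addrA.
Qed.

Lemma taylor_sobolev u w c0 c1 : L1 u -> L1 w -> taylor u c0 c1 w -> sobolev a b 2 u.
Proof.
move=> hu hw h; have [h1 h2] := taylor_weakd hu hw h.
split=> // -[|[|[|//]]] _.
- by exists u; split=> //; exact: weakd0.
- by exists (fun x => c1 + cprim w x); split=> //; exact: L1D (L1_cst _ _ _) (L1_cprim hw).
- by exists w; split=> //; exact: weakd_comp h1 h2.
Qed.

Lemma sobolev_le m n u : (m <= n)%N -> sobolev a b n u -> sobolev a b m u.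
Proof.
by move=> mn [hu h]; split=> // k km; apply: h; exact: leq_trans km mn.
Qed.

Lemma wderivP n u : (exists v, L1 v /\ weakd n u v) ->
  L1 (wderiv a b n u) /\ weakd n u (wderiv a b n u).
Proof.
exact: xgetPex.
Qed.

Lemma sobolev_taylor u : sobolev a b 2 u ->
  L1 (wderiv a b 2 u) /\ exists c0 c1, taylor u c0 c1 (wderiv a b 2 u).
Proof.
move=> [hu h]; have [hw uw] := wderivP (h 2%N isT); split=> //.
have [v [hv uv]] := h 1%N isT.
exact: weakd_taylor hu hv hw uv (weakd_step uv uw).
Qed.

Lemma taylor_wderiv u w c0 c1 : L1 u -> L1 w -> taylor u c0 c1 w -> aeeq (wderiv a b 2 u) w.
Proof.
move=> hu hw h; have [h1 h2] := taylor_weakd hu hw h.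
have [hw' h2'] : L1 (wderiv a b 2 u) /\ weakd 2 u (wderiv a b 2 u).
  by apply: wderivP; exists w; split=> //; exact: weakd_comp h1 h2.
have /weakd1P[k1 k2] := h2; have /weakd1P[k1' k2'] := weakd_step h1 h2'.
have e1 := has_wderiv_unique hw'.1 hw.1 k1' k1; have e2 := has_wderiv_unique hw'.2 hw.2 k2' k2.
apply: ae_sub (ae_and e1 e2) => x [i1 i2] xD.
by apply: complex_ext; [exact: i1|exact: i2].
Qed.

Lemma taylor_lin (c : R[i]) u c0 c1 w u' c0' c1' w' : L1 w -> L1 w' ->
  taylor u c0 c1 w -> taylor u' c0' c1' w' ->
  taylor (fun x => c * u x + u' x) (c * c0 + c0') (c * c1 + c1') (fun x => c * w x + w' x).
Proof.
move=> hw hw' h h'; apply: aeeq_trans (aeeqD (aeeqZ c h) h') _.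
apply: aeeq_eq => x xD.
have -> : cprim (cprim (fun y => c * w y + w' y)) x = c * cprim (cprim w) x + cprim (cprim w') x.
  rewrite -cprimZ; last exact: L1_cprim.
  rewrite -cprimD; [|exact/L1Z/L1_cprim|exact: L1_cprim].
  by apply: eq_cprim => y _; rewrite cprimD ?cprimZ//; exact: L1Z.
move: (cprim (cprim w) x) (cprim (cprim w') x) (x%:C) => A B D.
by rewrite !mulrDr mulrDl mulrA addrACA; congr (_ + _); rewrite addrACA.
Qed.

(** A solution of [u'' - q u = f] with Cauchy data [c0] and [c1] at 0, as an
    integral equation. Unlike the weak formulation it displays the initial data
    and is well suited to estimates; that [q u] be integrable, though [q] is not
    bounded, is part of the notion. *)
Definition solution q u f (c0 c1 : R[i]) : Prop :=
  [/\ L1 u, L1 (fun x => q x * u x), L1 f & taylor u c0 c1 (fun x => q x * u x + f x)].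

Lemma solution_sobolev q u f c0 c1 : solution q u f c0 c1 ->
  sobolev a b 2 u /\ aeeq (Lop a b q u) f.
Proof.
move=> [hu hqu hf h]; have hw := L1D hqu hf.
split; first exact: taylor_sobolev hu hw h.
apply: ae_sub (taylor_wderiv hu hw h) => x hx xD.
by rewrite /Lop hx// addrC addKr.
Qed.

Lemma weak_of_solution q u f c0 c1 : solution q u f c0 c1 -> weak_solution a b q u f.
Proof.
move=> [hu hqu hf h]; have hw := L1D hqu hf.
split; first exact: (@sobolev_le 1 2 _ isT) (taylor_sobolev hu hw h).
move=> psi tp; have cp := test_continuous tp.
have cp2 := test_continuous (test_deriv ab (test_deriv ab tp)).
have [h1 h2] := taylor_weakd hu hw h.
have := weakd_comp h1 h2 tp; rewrite sqrrN expr1n mul1r => E.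
rewrite cintB; [|exact: (L1_test hu cp2)|exact: (L1_test hqu cp)].
rewrite E -cintB; [|exact: (L1_test hw cp)|exact: (L1_test hqu cp)].
by apply: eq_cint => x _; ring.
Qed.

(** A function of W^{1,1} is a.e. a primitive up to a constant, hence bounded,
    so that [q u] is integrable; the equation then says that the first weak
    derivative of [u] has a weak derivative in L^1. *)
Lemma solution_of_weak q u f : L1 q -> L1 f -> weak_solution a b q u f ->
  exists c0 c1, solution q u f c0 c1.
Proof.
move=> hq hf [[hu h] sol].
have [d [hd ud]] := h 1%N isT.
have [c hc] := weakd1_primitive hu hd ud.
have mu := L1_cmeasurable hu.
have hqu : L1 (fun x => q x * u x).
  have hJ : L1 (fun x => q x * (c + cprim d x)).
    apply: (@L1_mul _ _ _ _ _ (norm1 c + normL1 a b d)) => //.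
      exact: L1_cmeasurable (L1D (L1_cst _ _ _) (L1_cprim hd)).
    by move=> x _; rewrite (le_trans (norm1D _ _))// lerD2l cprim_norm_le.
  apply: L1_ae hJ; first exact: aeeqM (aeeq_sym hc).
  exact: cmeasurableM (L1_cmeasurable hq) mu.
have hw := L1D hqu hf.
have uw : weakd 2 u (fun x => q x * u x + f x).
  move=> psi tp; have cp := test_continuous tp.
  have cp2 := test_continuous (test_deriv ab (test_deriv ab tp)).
  have := sol psi tp; rewrite cintB; [|exact: (L1_test hu cp2)|exact: (L1_test hqu cp)].
  move=> /eqP; rewrite subr_eq => /eqP ->.
  rewrite sqrrN expr1n mul1r -cintD; [|exact: (L1_test hf cp)|exact: (L1_test hqu cp)].
  by apply: eq_cint => x _; ring.
have [c0 [c1 hr]] := weakd_taylor hu hd hw ud (weakd_step ud uw).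
by exists c0, c1.
Qed.

Lemma solution_lin q (c : R[i]) u f c0 c1 u' f' c0' c1' :
  solution q u f c0 c1 -> solution q u' f' c0' c1' ->
  solution q (fun x => c * u x + u' x) (fun x => c * f x + f' x) (c * c0 + c0') (c * c1 + c1').
Proof.
move=> [hu hqu hf h] [hu' hqu' hf' h'].
have E : (fun x => q x * (c * u x + u' x)) = (fun x => c * (q x * u x) + q x * u' x).
  by apply/funext => x; ring.
have hq2 : L1 (fun x => q x * (c * u x + u' x)) by rewrite E; exact: L1D (L1Z _ hqu) hqu'.
have hf2 := L1D (L1Z c hf) hf'.
have E2 : (fun x => q x * (c * u x + u' x) + (c * f x + f' x)) =
    (fun x => c * (q x * u x + f x) + (q x * u' x + f' x)).
  by apply/funext => x; ring.
split; [exact: L1D (L1Z _ hu) hu'|exact: hq2|exact: hf2|rewrite E2].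
exact: taylor_lin (L1D hqu hf) (L1D hqu' hf') h h'.
Qed.

Lemma solution_ae q u f u' f' c0 c1 : L1 q -> L1 u' -> L1 f' -> aeeq u u' -> aeeq f f' ->
  solution q u f c0 c1 -> solution q u' f' c0 c1.
Proof.
move=> hq hu' hf' uu ff [hu hqu hf h].
have hqu' : L1 (fun x => q x * u' x).
  by apply: L1_ae hqu; [exact: aeeqM|exact: cmeasurableM (L1_cmeasurable hq) (L1_cmeasurable hu')].
split; [exact: hu'|exact: hqu'|exact: hf'|].
apply: aeeq_trans (aeeq_sym uu) _; apply: aeeq_trans h _.
have E x : cprim (cprim (fun y => q y * u y + f y)) x = cprim (cprim (fun y => q y * u' y + f' y)) x.
  apply: eq_cprim => y _; apply: cprim_ae; [exact: L1D hqu hf|exact: L1D hqu' hf'|].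
  by apply: aeeqD; [exact: aeeqM|exact: ff].
by apply: aeeq_eq => x _; rewrite E.
Qed.

Lemma cprim20 x : cprim (cprim (fun=> 0)) x = 0.
Proof.
have J0 y : cprim (fun=> 0) y = 0.
  transitivity (0 * cprim (fun=> 0) y); last by rewrite mul0r.
  rewrite -cprimZ; last exact: L1_cst.
  by apply: eq_cprim => z _; rewrite mul0r.
by rewrite (eq_cprim (v := fun=> 0))// => y _; rewrite J0.
Qed.

Lemma solution0 q : solution q (fun=> 0) (fun=> 0) 0 0.
Proof.
have h0 := L1_cst a b (0 : R[i]).
have hq0 : L1 (fun x => q x * 0) by apply: eq_L1 h0 => x _; rewrite mulr0.
split; [exact: h0|exact: hq0|exact: h0|]; apply: aeeq_eq => x _.
rewrite mul0r !add0r (_ : (fun _ => _) = fun=> 0) ?cprim20//.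
by apply/funext => y; rewrite mulr0 addr0.
Qed.

(** A C^1 representative with zero value and slope at 0 is [o(x)] there, and so
    is the twofold primitive; what remains in Taylor's formula is affine. *)
Lemma C1_initial u w c0 c1 v v1 : L1 w -> taylor u c0 c1 w ->
  C1_representative a b u v v1 -> v 0 = 0 -> v1 0 = 0 -> c0 = 0 /\ c1 = 0.
Proof.
move=> [w1 w2] h [uv C1 C2] v0 v10.
have e1 : aeeqr a b (fun x => Re c0 + Re c1 * x + prim a b (prim a b (fun y => Re (w y))) x) (fun x => Re (v x)).
  apply: ae_sub (ae_and uv h) => x [h1 h2] xD.
  by rewrite -h1// h2// !cReD cReM (cRe_real x) (cIm_real x) mulr0 subr0.
have e2 : aeeqr a b (fun x => Im c0 + Im c1 * x + prim a b (prim a b (fun y => Im (w y))) x) (fun x => Im (v x)).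
  apply: ae_sub (ae_and uv h) => x [h1 h2] xD.
  by rewrite -h1// h2// !cImD cImM (cRe_real x) (cIm_real x) mulr0 add0r.
have f1 : little_at0 a b (fun x => Re (v x)) by apply: (C1_little_at0 ha hb C1); rewrite ?v0 ?v10.
have f2 : little_at0 a b (fun x => Im (v x)) by apply: (C1_little_at0 ha hb C2); rewrite ?v0 ?v10.
have [r0 r1] := affine_little_at0 ab ha hb (prim2_little_at0 ab ha hb w1) f1 e1.
have [i0 i1] := affine_little_at0 ab ha hb (prim2_little_at0 ab ha hb w2) f2 e2.
by split; apply: complex_ext.
Qed.

(** The integral equation gives
    [|g(x)| <= (b - a) (\int_0^x |q| |g| + \int_0^x |f|)], to which Gronwall's
    inequality applies: a solution with zero Cauchy data is controlled uniformly
    by the L^1 norm of its right hand side alone. *)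
Lemma solution_bound q : L1 q -> exists2 C : R, 0 <= C &
  forall g f, L1 g -> L1 (fun x => q x * g x) -> L1 f ->
    (forall x, x \in `]a, b[ -> g x = cprim (cprim (fun y => q y * g y + f y)) x) ->
    forall x, x \in `]a, b[ -> norm1 (g x) <= C * normL1 a b f.
Proof.
move=> hq; have b0 : 0 <= b - a by rewrite subr_ge0 ltW.
pose Q x := (b - a) * norm1 (q x).
have hQ : integ a b Q by exact/integZ/integ_norm1.
have [|C C0 hC] := gronwall ab ha hb hQ.
  by move=> x _; rewrite mulr_ge0 ?norm1_ge0.
exists (C * (b - a)); first by rewrite mulr_ge0.
move=> g f hg hqg hf gE x xD; rewrite -mulrA.
have hF := L1D hqg hf.
have gM y : y \in `]a, b[ -> norm1 (g y) <= (b - a) * normL1 a b (fun y => q y * g y + f y).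
  by move=> yD; rewrite gE// cprim2_norm_le.
apply: (hC (fun x => norm1 (g x)) _ ((b - a) * normL1 a b (fun y => q y * g y + f y))) => //.
- by rewrite mulr_ge0// normL1_ge0.
- exact: measurable_norm1 (L1_cmeasurable hg).
- by move=> y yD; rewrite norm1_ge0 gM.
move=> y yD; rewrite {1}gE// (le_trans (cprim2_norm_ker ab hF yD))//.
have iqg : integ a b (fun z => norm1 (g z) * norm1 (q z)).
  apply: (@integ_mul _ _ _ _ _ ((b - a) * normL1 a b (fun y => q y * g y + f y)) (integ_norm1 hq)).
    exact: measurable_norm1 (L1_cmeasurable hg).
  by move=> z zD; rewrite ger0_norm ?norm1_ge0 ?gM.
have iQg : integ a b (fun z => Q z * norm1 (g z)).
  by apply: (eq_integ _ (integZ (b - a) iqg)) => z _; rewrite /Q; ring.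
rewrite (_ : Int a b (fun y0 => `|ker y y0| * (Q y0 * norm1 (g y0))) =
   (b - a) * Int a b (fun z => `|ker y z| * (norm1 (g z) * norm1 (q z)))); last first.
  rewrite -IntZ; last exact: integ_normr_ker.
  by apply: eq_Int => z _; rewrite /Q; ring.
rewrite -mulrDr ler_wpM2l// /normL1 -IntD; [|exact: integ_normr_ker|exact: integ_norm1].
apply: Int_le.
- exact/integ_normr_ker/integ_norm1.
- by apply: integD; [exact: integ_normr_ker|exact: integ_norm1].
- move=> z zD; rewrite (@le_trans _ _ (`|ker y z| * (norm1 (g z) * norm1 (q z) + norm1 (f z))))//.
    rewrite ler_wpM2l// (le_trans (norm1D _ _))// lerD2r mulrC.
    by rewrite mulrC [leRHS]mulrC; exact: norm1M.
  by rewrite mulrDr lerD2l ler_piMl ?norm1_ge0// ker_norm.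
Qed.

End Sobolev.

(** * Passing from polynomials to integrable functions *)
Section Main.
Local Open Scope complex_scope.
Context {R : realType} (a b : R) (ab : a < b) (ha : a <= 0) (hb : 0 <= b).
Implicit Types u v w f g : R -> R[i].
Notation Re := complex.Re.
Notation Im := complex.Im.
Notation L1 := (L1 a b).
Notation aeeq := (aeeq a b).
Notation cprim := (cprim a b).
Notation normL1 := (normL1 a b).
Notation solution := (solution a b).

Lemma prim_exprn k (x : R) : x \in `[a, b] ->
  prim a b (fun y => y ^+ k) x = k.+1%:R^-1 * x ^+ k.+1.
Proof.
move=> xab; have := @prim_horner R a b ha hb (k.+1%:R^-1 *: 'X^(k.+1)) x xab.
rewrite !hornerE /= expr0n mulr0 subr0 => <-; apply: eq_prim => y _.
by rewrite derivZ derivXn hornerZ hornerMn hornerXn -[_ ^+ _ *+ _]mulr_natl mulKf// pnatr_eq0.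
Qed.

Lemma L1_monomial k : L1 (@monomial R k).
Proof.
apply: L1_mk; last exact: integ_cst.
by apply: integ_continuous; exact: exprn_continuous.
Qed.

Lemma cprim_monomial k x : x \in `[a, b] ->
  cprim (@monomial R k) x = (k.+1%:R^-1)%:C * @monomial R k.+1 x.
Proof.
move=> xab; apply: complex_ext.
  by rewrite cReM /= mul0r subr0 -prim_exprn.
rewrite cImM /= mulr0 mul0r addr0.
by rewrite /prim (@eq_Int _ _ _ _ (fun=> 0)) ?Int_cst ?mul0r ?(ltW ab)// => y _; rewrite mulr0.
Qed.

Lemma cprim2_monomial k x : x \in `]a, b[ ->
  cprim (cprim (@monomial R k)) x = (k.+1%:R^-1 * k.+2%:R^-1)%:C * @monomial R k.+2 x.
Proof.
move=> xD; rewrite (@eq_cprim _ _ _ _ (fun y => (k.+1%:R^-1)%:C * @monomial R k.+1 y)).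
  rewrite cprimZ; last exact: L1_monomial.
  by rewrite cprim_monomial ?(subset_itv_oo_cc xD)// mulrA -rmorphM.
by move=> y yD; rewrite cprim_monomial// (subset_itv_oo_cc yD).
Qed.

Fixpoint cpoly (c : nat -> R[i]) n x : R[i] :=
  if n is n'.+1 then c n' * @monomial R n' x + cpoly c n' x else 0.

Lemma cpolyE c n x : cpoly c n x = \sum_(i < n) c i * (x%:C) ^+ i.
Proof.
elim: n => [|n IH] /=; first by rewrite big_ord0.
by rewrite big_ord_recr /= IH addrC /monomial rmorphXn.
Qed.

Lemma L1_cpoly c n : L1 (cpoly c n).
Proof.
elim: n => [|n IH]; first exact: L1_cst.
exact: L1D (L1Z _ (L1_monomial n)) IH.
Qed.

Lemma cpoly_taylor c n : exists c0 c1 w, L1 w /\ taylor a b (cpoly c n) c0 c1 w.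
Proof.
elim: n => [|n [c0 [c1 [w [hw h]]]]].
  exists 0, 0, (fun=> 0); split; first exact: L1_cst.
  by apply: aeeq_eq => x _; rewrite cprim20 mul0r !addr0.
have [d0 [d1 [v [hv h']]]] : exists d0 d1 v, L1 v /\ taylor a b (@monomial R n) d0 d1 v.
  case: n {h} => [|[|n]].
  - exists 1, 0, (fun=> 0); split; first exact: L1_cst.
    by apply: aeeq_eq => x _; rewrite cprim20 mul0r !addr0 /monomial expr0.
  - exists 0, 1, (fun=> 0); split; first exact: L1_cst.
    by apply: aeeq_eq => x _; rewrite cprim20 mul1r addr0 add0r /monomial expr1.
  - exists 0, 0, (fun x => (n.+1%:R * n.+2%:R)%:C * @monomial R n x); split.
      exact/L1Z/L1_monomial.
    apply: aeeq_eq => x xD; rewrite mul0r !add0r.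
    rewrite (@eq_cprim _ _ _ _ (fun y => (n.+1%:R * n.+2%:R)%:C * cprim (@monomial R n) y)); last first.
      by move=> y _; rewrite cprimZ//; exact: L1_monomial.
    rewrite cprimZ; last exact/L1_cprim/L1_monomial.
    have E : n.+1%:R * n.+2%:R * (n.+1%:R^-1 * n.+2%:R^-1) = 1 :> R.
      by rewrite -invfM divff// mulf_neq0// pnatr_eq0.
    by rewrite cprim2_monomial// mulrA -rmorphM /= E mul1r.
exists (c n * d0 + c0), (c n * d1 + c1), (fun x => c n * v x + w x).
split; first exact: L1D (L1Z _ hv) hw.
rewrite -[cpoly c n.+1]/(fun x => c n * @monomial R n x + cpoly c n x).
exact: taylor_lin hv hw h' h.
Qed.

Lemma Re_cpoly c n x : Re (cpoly c n x) = \sum_(i < n) Re (c i) * x ^+ i.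
Proof.
elim: n => [|n IH] /=; first by rewrite big_ord0.
by rewrite big_ord_recr !cE IH mulr0 subr0 addrC.
Qed.

Lemma Im_cpoly c n x : Im (cpoly c n x) = \sum_(i < n) Im (c i) * x ^+ i.
Proof.
elim: n => [|n IH] /=; first by rewrite big_ord0.
by rewrite big_ord_recr !cE IH mulr0 add0r addrC.
Qed.

(** Real and imaginary parts are approximated separately. *)
Lemma cpoly_dense w (e : R) : L1 w -> 0 < e ->
  exists n c, normL1 (fun x => w x - cpoly c n x) <= e.
Proof.
move=> [w1 w2] e0; have e2 : 0 < e / 2 by rewrite divr_gt0.
have [p hp] := poly_dense ab w1 e2; have [r hr] := poly_dense ab w2 e2.
pose n := maxn (size p) (size r).
exists n, (fun k => p`_k +i* r`_k).
have cp (s : {poly R}) : continuous (horner s) by exact: continuous_horner.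
rewrite [leRHS]splitr (le_trans _ (lerD hp hr))//.
rewrite -IntD; [|exact/integ_norm/integB/integ_continuous|exact/integ_norm/integB/integ_continuous].
rewrite le_eqVlt; apply/orP; left; apply/eqP; apply: eq_Int => x _.
rewrite /norm1 !(cReD, cImD, cReN, cImN) Re_cpoly Im_cpoly /=.
by rewrite -!horner_coef_wide ?leq_maxl ?leq_maxr.
Qed.

(** The limit is the supremum of the lower bounds [x n - K / (n + 1)], each of
    which is below each of the upper bounds [x m + K / (m + 1)]. *)
Lemma harmonic_cauchy (x : nat -> R) (K : R) :
  (forall n m, `|x n - x m| <= K * (n.+1%:R^-1 + m.+1%:R^-1)) ->
  exists l, forall n, `|x n - l| <= K * n.+1%:R^-1.
Proof.
move=> h; pose S := range (fun n => x n - K * n.+1%:R^-1).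
have ub m : ubound S (x m + K * m.+1%:R^-1).
  move=> _ [n _ <-]; have := le_trans (ler_norm _) (h n m).
  by rewrite mulrDr /=; move: (K * n.+1%:R^-1) (K * m.+1%:R^-1) => s t; lra.
have hub : has_ubound S by exists (x 0%N + K * 1%:R^-1); exact: ub.
have S0 : S !=set0 by exists (x 0%N - K * 1%:R^-1); exists 0%N.
exists (sup S) => n.
have h1 : sup S <= x n + K * n.+1%:R^-1 by exact: ge_sup.
have h2 : x n - K * n.+1%:R^-1 <= sup S by apply: ub_le_sup => //; exists n.
move: h1 h2; move: (K * n.+1%:R^-1) (sup S) => s t h1 h2.
by rewrite ler_norml; apply/andP; split; lra.
Qed.

Lemma harmonic_le0 (x K : R) : (forall n, x <= K * n.+1%:R^-1) -> x <= 0.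
Proof.
move=> h; rewrite leNgt; apply/negP => x0.
pose n := Num.truncn (K / x); have := h n.
apply/negP; rewrite -ltNge ltr_pdivrMr// mulrC -ltr_pdivrMr//.
exact: truncnS_gt.
Qed.

Context (q : R -> R[i]) (hq : L1 q).
Context (T : (R -> R[i]) -> R -> R[i]) (hT : bounded_linear_L1 a b T).

Lemma op_L1 u : L1 u -> L1 (T u).
Proof. by case: hT => _ h _; exact: h. Qed.

Lemma op_ae u v : L1 u -> L1 v -> aeeq u v -> aeeq (T u) (T v).
Proof. by case: hT => -[_ h _] _ _; exact: h. Qed.

Lemma op_lin c u v : L1 u -> L1 v ->
  aeeq (T (fun x => c * u x + v x)) (fun x => c * T u x + T v x).
Proof. by case: hT => -[_ _ h] _ _ hu hv; case: (h c u v hu hv). Qed.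

Lemma op_0 : aeeq (T (fun=> 0)) (fun=> 0).
Proof.
have h0 := L1_cst a b (0 : R[i]); have := op_lin (-1) h0 h0.
rewrite (_ : (fun x => _) = fun=> 0); last by apply/funext => x; rewrite mulr0 addr0.
by apply: ae_sub => x h xD; rewrite h// mulN1r addNr.
Qed.

Lemma op_sub u v : L1 u -> L1 v ->
  aeeq (T (fun x => u x - v x)) (fun x => T u x - T v x).
Proof.
move=> hu hv; have := op_lin (-1) hv hu.
rewrite (_ : (fun x => -1 * v x + u x) = fun x => u x - v x); last first.
  by apply/funext => x; rewrite mulN1r addrC.
by apply: ae_sub => x h xD; rewrite h// mulN1r addrC.
Qed.

Lemma op_bound : exists2 K : R, 0 <= K & forall u, L1 u -> normL1 (T u) <= K * normL1 u.
Proof.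
case: hT => _ _ [M hM]; exists (2 * `|M|); first by rewrite mulr_ge0.
move=> u hu; rewrite (le_trans (normL1_le_L1norm (op_L1 hu)))// -mulrA ler_wpM2l//.
rewrite (le_trans (hM _ hu))// (@le_trans _ _ (`|M| * L1norm a b u))//.
  by rewrite ler_wpM2r ?L1norm_ge0// ler_norm.
by rewrite ler_wpM2l// L1norm_le_normL1.
Qed.

Context (Tsol : forall k, solution q (T (@monomial R k.+2))
  (fun x => (k.+1%:R * k.+2%:R)%:C * T (@monomial R k) x) 0 0).

(** The twofold primitive of [x^k] is [x^(k+2) / ((k+1)(k+2))], so that this is
    a linear combination of the hypotheses on the functions [T (x^(k+2))]. *)
Lemma solution_T_cpoly c n : solution q (T (cprim (cprim (cpoly c n)))) (T (cpoly c n)) 0 0.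
Proof.
elim: n => [|n IH].
  have h0 := L1_cst a b (0 : R[i]).
  apply: (solution_ae hq _ _ _ _ (solution0 a b q)).
  - exact/op_L1/L1_cprim/L1_cprim.
  - exact: op_L1.
  - rewrite (_ : cprim (cprim _) = fun=> 0); first exact: aeeq_sym op_0.
    by apply/funext => x; exact: cprim20.
  - exact: aeeq_sym op_0.
have hm := L1_monomial; have hp := L1_cpoly c n.
have hJp := L1_cprim (L1_cprim hp).
pose k : R := n.+1%:R^-1 * n.+2%:R^-1.
have := solution_lin (c n * k%:C) (Tsol n) IH; rewrite !mulr0 !addr0.
apply: solution_ae => //.
- exact/op_L1/L1_cprim/L1_cprim/L1_cpoly.
- exact/op_L1/L1_cpoly.
- apply: aeeq_trans (aeeq_sym (op_lin _ (hm _) hJp)) _.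
  apply: op_ae; [exact: L1D (L1Z _ (hm _)) hJp|exact/L1_cprim/L1_cprim/L1_cpoly|].
  apply: aeeq_eq => x xD; rewrite /= -mulrA -cprim2_monomial//.
  rewrite -cprimZ; last exact/L1_cprim.
  rewrite -cprimD; [|exact/L1Z/L1_cprim|exact: L1_cprim].
  by apply: eq_cprim => y _; rewrite -cprimZ// -cprimD//; exact: L1Z.
- apply: aeeq_trans _ (aeeq_sym (op_lin (c n) (hm n) hp)).
  apply: aeeq_eq => x _; congr (_ + _); rewrite mulrA -[X in X * _]mulrA -rmorphM /=.
  rewrite (_ : k * (n.+1%:R * n.+2%:R) = 1) ?mulr1//.
  by rewrite /k -invfM mulVf// mulf_neq0// pnatr_eq0.
Qed.

(** Let polynomials [r_n] tend to [w] in L^1. The solutions [T (cprim (cprim r_n))]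
    have zero Cauchy data, so that [solution_bound] makes their representatives
    [h n] a uniform Cauchy sequence. Uniform convergence survives multiplication
    by the integrable [q], and the limit [l] solves the integral equation with
    right hand side [T w]. As [T] is bounded, [l] is also the L^1 limit
    [T (cprim (cprim w))]. *)
Lemma solution_T w : L1 w -> solution q (T (cprim (cprim w))) (T w) 0 0.
Proof.
move=> hw; have b0 : 0 <= b - a by rewrite subr_ge0 ltW.
have [K K0 hK] := op_bound; have [C C0 hC] := solution_bound ab ha hb hq.
have /choice[r hr] : forall n, exists r : R -> R[i], [/\ L1 r,
    normL1 (fun x => w x - r x) <= n.+1%:R^-1 & solution q (T (cprim (cprim r))) (T r) 0 0].
  move=> n; have n0 : 0 < n.+1%:R^-1 :> R by rewrite invr_gt0.
  have [m [c hc]] := cpoly_dense hw n0; exists (cpoly c m); split=> //.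
    exact: L1_cpoly.
  exact: solution_T_cpoly.
have Lr n : L1 (r n) by case: (hr n).
have Nr n : normL1 (fun x => w x - r n x) <= n.+1%:R^-1 by case: (hr n).
have NTr n : normL1 (fun x => T w x - T (r n) x) <= K * n.+1%:R^-1.
  have -> : normL1 (fun x => T w x - T (r n) x) = normL1 (T (fun x => w x - r n x)).
    by apply: normL1_ae; [exact: L1B (op_L1 hw) (op_L1 _)|exact/op_L1/L1B|exact/aeeq_sym/op_sub].
  by rewrite (le_trans (hK _ (L1B hw (Lr n))))// ler_wpM2l.
pose g n := T (cprim (cprim (r n))).
have Lg n : L1 (g n) by exact/op_L1/L1_cprim/L1_cprim.
have Lqg n : L1 (fun x => q x * g n x) by case: (hr n) => _ _ [].
have LF n : L1 (fun x => q x * g n x + T (r n) x) by exact: L1D (Lqg n) (op_L1 (Lr n)).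
(* [h n] is the representative of [g n] given by the integral equation; it is
   kept abstract, known through [hdef] only. *)
have [h hdef] : exists h : nat -> R -> R[i], forall n x,
    h n x = cprim (cprim (fun y => q y * g n y + T (r n) y)) x.
  by exists (fun n => cprim (cprim (fun y => q y * g n y + T (r n) y))).
have gh n : aeeq (g n) (h n).
  case: (hr n) => _ _ [_ _ _]; apply: ae_sub => x e xD.
  by rewrite hdef /g e// mul0r !add0r.
have Lh n : L1 (h n).
  by apply: eq_L1 (L1_cprim (L1_cprim (LF n))) => x _; rewrite hdef.
have Lqh n : L1 (fun x => q x * h n x).
  apply: L1_ae (Lqg n); first exact: aeeqM.
  exact: cmeasurableM (L1_cmeasurable hq) (L1_cmeasurable (Lh n)).
have hE n x : h n x = cprim (cprim (fun y => q y * h n y + T (r n) y)) x.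
  rewrite hdef; apply: eq_cprim => y _; apply: cprim_ae; [exact: LF|exact: L1D (Lqh n) (op_L1 (Lr n))|].
  by apply: aeeqD; [exact: aeeqM|exact: aeeq_refl].
pose M := C * K.
have hcauchy n m x : x \in `]a, b[ -> norm1 (h n x - h m x) <= M * (n.+1%:R^-1 + m.+1%:R^-1).
  move=> xD.
  have Lf : L1 (fun x => T (r n) x - T (r m) x) by exact: L1B (op_L1 (Lr n)) (op_L1 (Lr m)).
  have Eq : (fun y => q y * (h n y - h m y)) = (fun y => q y * h n y - q y * h m y).
    by apply/funext => y; rewrite mulrBr.
  have Lqd : L1 (fun y => q y * (h n y - h m y)) by rewrite Eq; exact: L1B.
  have LhT k : L1 (fun y => q y * h k y + T (r k) y) by exact: L1D (Lqh k) (op_L1 (Lr k)).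
  rewrite (le_trans (hC (fun x => h n x - h m x) _ (L1B (Lh n) (Lh m)) Lqd Lf _ x xD))//.
    move=> y yD; rewrite [in LHS]hE [h m y]hE -cprimB; [|exact/L1_cprim/LhT|exact/L1_cprim/LhT].
    apply: eq_cprim => z _; rewrite -cprimB; [|exact: LhT|exact: LhT].
    by apply: eq_cprim => t _; rewrite mulrBr opprD addrACA.
  rewrite /M -mulrA ler_wpM2l//.
  rewrite (@le_trans _ _ (normL1 (fun x => T w x - T (r m) x) + normL1 (fun x => T w x - T (r n) x)))//.
    rewrite [leLHS](_ : _ = normL1 (fun x => (T w x - T (r m) x) - (T w x - T (r n) x))).
      by apply: normL1B; exact: L1B (op_L1 hw) (op_L1 _).
    by apply: eq_normL1 => y _; congr norm1; ring.
  by rewrite mulrDr addrC lerD.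
have /choice[l hl] : forall x, exists z : R[i], x \in `]a, b[ ->
    forall n, `|Re (h n x) - Re z| <= M * n.+1%:R^-1 /\ `|Im (h n x) - Im z| <= M * n.+1%:R^-1.
  move=> x; have [xD|_] := boolP (x \in `]a, b[); last by exists 0.
  have [|l1 h1] := @harmonic_cauchy (fun n => Re (h n x)) M.
    move=> n m; rewrite (le_trans _ (hcauchy n m x xD))//.
    by rewrite /norm1 cReD cReN lerDl.
  have [|l2 h2] := @harmonic_cauchy (fun n => Im (h n x)) M.
    move=> n m; rewrite (le_trans _ (hcauchy n m x xD))//.
    by rewrite /norm1 cImD cImN lerDr.
  by exists (l1 +i* l2) => _ n.
have hl2 n x : x \in `]a, b[ -> norm1 (l x - h n x) <= 2 * M * n.+1%:R^-1.
  move=> xD; have [h1 h2] := hl x xD n.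
  by rewrite -norm1N opprB /norm1 !cE -mulrA mulr2n mulrDl mul1r lerD.
have Ml : cmeasurable a b l.
  have aux (f : nat -> R -> R) (f0 : R -> R) : (forall n, measurable_fun `]a, b[ (f n)) ->
      (forall x, x \in `]a, b[ -> forall n, `|f n x - f0 x| <= M * n.+1%:R^-1) ->
      measurable_fun `]a, b[ f0.
    move=> mf hf; apply: (measurable_fun_cvg mf) => x xD.
    apply/cvgrPdist_le => e e0.
    have M1 : 0 < M + 1 by rewrite ltr_wpDl// mulr_ge0.
    have e1 : 0 < e / (M + 1) by rewrite divr_gt0.
    have /cvgrPdist_lt/(_ _ e1)[n0 _ hn0] := @cvg_harmonic R.
    exists n0 => // n /= /hn0; rewrite sub0r normrN gtr0_norm ?/harmonic ?invr_gt0// => hn.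
    rewrite distrC (le_trans (hf _ xD n))// (@le_trans _ _ ((M + 1) * n.+1%:R^-1))//.
      by rewrite ler_wpM2r ?invr_ge0// lerDl.
    by rewrite mulrC -ler_pdivlMr// ltW.
  split.
    apply: (aux (fun n x => Re (h n x))) => [n|x xD n]; first by have [] := L1_cmeasurable (Lh n).
    by case: (hl x xD n).
  apply: (aux (fun n x => Im (h n x))) => [n|x xD n]; first by have [] := L1_cmeasurable (Lh n).
  by case: (hl x xD n).
have Ld n : L1 (fun x => l x - h n x).
  apply: (@L1_le _ _ _ _ (fun=> 2 * M * n.+1%:R^-1)).
  - exact: cmeasurableB Ml (L1_cmeasurable (Lh n)).
  - exact: integ_cst.
  - by move=> x; exact: hl2.
have Ll : L1 l by apply: eq_L1 (L1D (Ld 0%N) (Lh 0%N)) => x _; rewrite subrK.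
have Lqd n : L1 (fun x => q x * (l x - h n x)).
  exact: L1_mul hq (L1_cmeasurable (Ld n)) (hl2 n).
have Lql : L1 (fun x => q x * l x).
  by apply: eq_L1 (L1D (Lqd 0%N) (Lqh 0%N)) => x _; rewrite -mulrDr subrK.
have Nqd n : normL1 (fun x => q x * (l x - h n x)) <= 2 * M * n.+1%:R^-1 * normL1 q.
  rewrite -IntZ; last exact: integ_norm1.
  apply: Int_le; [exact: integ_norm1|exact/integZ/integ_norm1|].
  move=> x xD; rewrite (le_trans (norm1M _ _))// mulrC ler_wpM2r ?norm1_ge0//.
  exact: hl2.
have LE := L1D Lql (op_L1 hw).
have lE x : x \in `]a, b[ -> l x = cprim (cprim (fun y => q y * l y + T w y)) x.
  move=> xD; apply/eqP; rewrite -subr_eq0; apply/eqP/norm1_eq0.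
  apply: (@harmonic_le0 _ (2 * M + (b - a) * (2 * M * normL1 q + K))) => n.
  have -> : l x - cprim (cprim (fun y => q y * l y + T w y)) x =
      (l x - h n x) - cprim (cprim (fun y => q y * (l y - h n y) + (T w y - T (r n) y))) x.
    rewrite -addrA; congr (_ + _); rewrite -opprD; congr (- _).
    rewrite {1}hE -cprimD; [|exact/L1_cprim/L1D/op_L1|exact/L1_cprim/L1D/L1B/op_L1/Lr/op_L1].
    apply: eq_cprim => y _; rewrite -cprimD; [|exact/L1D/op_L1|exact/L1D/L1B/op_L1/Lr/op_L1].
    by apply: eq_cprim => z _; ring.
  have Ldiff : L1 (fun x => T w x - T (r n) x) by exact: L1B (op_L1 hw) (op_L1 (Lr n)).
  rewrite (le_trans (norm1B _ _))// mulrDl lerD ?hl2//.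
  rewrite (le_trans (cprim2_norm_le ab (L1D (Lqd n) Ldiff) xD))// -mulrA ler_wpM2l//.
  by rewrite (le_trans (normL1D (Lqd n) Ldiff))// mulrDl lerD// (le_trans (Nqd n))// mulrAC.
have Lu : L1 (T (cprim (cprim w))) by exact/op_L1/L1_cprim/L1_cprim.
have ul : aeeq (T (cprim (cprim w))) l.
  have Lul : L1 (fun x => T (cprim (cprim w)) x - l x) by exact: L1B.
  suff : normL1 (fun x => T (cprim (cprim w)) x - l x) = 0.
    by move=> /(normL1_eq0 Lul); apply: ae_sub => x e /e /eqP; rewrite subr_eq0 => /eqP.
  apply/le_anti; rewrite normL1_ge0 andbT.
  apply: (@harmonic_le0 _ (K * ((b - a) * (b - a)) + 2 * M * (b - a))) => n.
  have L2 : L1 (fun x => T (cprim (cprim w)) x - g n x) by exact: L1B Lu (Lg n).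
  have -> : normL1 (fun x => T (cprim (cprim w)) x - l x) =
      normL1 (fun x => (T (cprim (cprim w)) x - g n x) - (l x - h n x)).
    apply: normL1_ae => //; first exact: L1B.
    by apply: ae_sub (gh n) => x e xD; rewrite e//; ring.
  rewrite (le_trans (normL1B L2 (Ld n)))// mulrDl lerD//.
    have Lwr := L1B hw (Lr n).
    have -> : normL1 (fun x => T (cprim (cprim w)) x - g n x) = normL1 (T (cprim (cprim (fun x => w x - r n x)))).
      apply: normL1_ae; [exact: L2|exact: op_L1 (L1_cprim (L1_cprim Lwr))|].
      apply: aeeq_trans (aeeq_sym (op_sub (L1_cprim (L1_cprim hw)) (L1_cprim (L1_cprim (Lr n))))) _.
      apply: op_ae; [exact: L1B (L1_cprim (L1_cprim hw)) (L1_cprim (L1_cprim (Lr n)))|exact/L1_cprim/L1_cprim|].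
      apply: aeeq_eq => x _; rewrite -cprimB; [|exact: L1_cprim|exact: L1_cprim].
      by apply: eq_cprim => y _; rewrite -cprimB.
    rewrite (le_trans (hK _ (L1_cprim (L1_cprim Lwr))))// -mulrA ler_wpM2l//.
    rewrite (le_trans (normL1_cprim2 ab Lwr))// mulrAC ler_wpM2l// mulr_ge0//.
  rewrite mulrAC -Int_cst ?(ltW ab)//; apply: Int_le; [exact: integ_norm1|exact: integ_cst|].
  by move=> x; exact: hl2.
have sl : solution q l (T w) 0 0.
  split=> //; first exact: op_L1.
  by apply: aeeq_eq => x xD; rewrite mul0r !add0r -lE.
by apply: solution_ae sl => //; [exact: op_L1|exact: aeeq_sym|exact: aeeq_refl].
Qed.

End Main.

Theorem theorem10 (R : realType) (a b : R) (hab : a < b) (ha : a <= 0)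
    (hb : 0 <= b) (q : R -> R[i]) (hq : L1 a b q)
    (phi : nat -> R -> R[i]) (hphi : standard_L_base a b q phi)
    (T : (R -> R[i]) -> R -> R[i]) (hT : bounded_linear_L1 a b T)
    (hTphi : forall k : nat, aeeq a b (T (@monomial R k)) (phi k)) :
  standard_transmutation a b q (L1 a b) T (sobolev a b 2) /\
  (forall u : R -> R[i], sobolev a b 2 u ->
     sobolev a b 2 (T u) /\ aeeq a b (Lop a b q (T u)) (T (wderiv a b 2 u))).
Proof.
have hm k : L1 a b (@monomial R k) by exact: L1_monomial.
have hTm k : L1 a b (T (@monomial R k)) by exact: (op_L1 hT (hm k)).
have Lphi k : L1 a b (phi k).
  case: hphi => -[h0 h1 h2] _; case: k => [|[|k]]; first by case: h0 => -[].
    by case: h1 => -[].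
  by case: (h2 k.+2 isT) => -[].
have L0 : L1 a b (fun=> 0) by exact: L1_cst.
(* the Cauchy data of [phi 0] and [phi 1] are arbitrary *)
have phi0 k : (k < 2)%N -> exists c0 c1, solution a b q (T (@monomial R k)) (fun=> 0) c0 c1.
  case: hphi => -[h0 h1 _] _ k2.
  have hk : weak_solution a b q (phi k) (fun=> 0) by case: k k2 => [|[|//]].
  have [c0 [c1 hs]] := solution_of_weak hab ha hb hq L0 hk.
  exists c0, c1.
  exact: (solution_ae hq (hTm k) L0 (aeeq_sym (hTphi k)) (aeeq_refl _ _ _) hs).
have phi2 k : solution a b q (T (@monomial R k.+2))
    (fun x => (k.+2 * (k.+2 - 1))%:R * T (@monomial R (k.+2 - 2)) x) 0 0.
  case: hphi => -[_ _ h2] hst; have hk := h2 k.+2 isT.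
  have hf := L1Z ((k.+2 * (k.+2 - 1))%:R) (Lphi (k.+2 - 2)%N).
  have [c0 [c1 hs]] := solution_of_weak hab ha hb hq hf hk.
  have [v [v1 [hv v0 v10]]] := hst k.+2 isT.
  have [_ hqu _ hr] := hs.
  have [c00 c10] := C1_initial hab ha hb (L1D hqu hf) hr hv v0 v10.
  rewrite c00 c10 in hs.
  apply: (solution_ae hq (hTm k.+2) _ (aeeq_sym (hTphi k.+2)) _ hs).
    exact: L1Z.
  exact: aeeqZ (aeeq_sym (hTphi _)).
have Tsol k : solution a b q (T (@monomial R k.+2))
    (fun x => (k.+1%:R * k.+2%:R)%:C%C * T (@monomial R k) x) 0 0.
  have := phi2 k; rewrite subn1 subn2 /=.
  by rewrite -natrM rmorph_nat mulnC.
have Tmain u : sobolev a b 2 u ->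
    sobolev a b 2 (T u) /\ aeeq a b (Lop a b q (T u)) (T (wderiv a b 2 u)).
  move=> hu; have [hw [c0 [c1 hr]]] := sobolev_taylor hab ha hb hu.
  set w := wderiv a b 2 u in hw hr *.
  have [d0 [d1 s0]] := phi0 0%N isT; have [e0 [e1 s1]] := phi0 1%N isT.
  have sw := solution_T hab ha hb hq hT Tsol hw.
  have hJ := L1_cprim (L1_cprim hw).
  have [Lu _] := hu.
  have h1 := L1D (L1Z c1 (hm 1%N)) hJ.
  (* [T u = c0 T(1) + c1 T(x) + T (cprim (cprim w))], by Taylor's formula for [u] *)
  have := solution_lin c0 s0 (solution_lin c1 s1 sw); set k0 := (X in solution _ _ _ _ _ X _); set k1 := (X in solution _ _ _ _ _ _ X).
  move=> s.
  have hs : solution a b q (T u) (T w) k0 k1.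
    apply: (solution_ae hq (op_L1 hT Lu) (op_L1 hT hw) _ _ s).
      apply: aeeq_trans (aeeqD (aeeq_refl _ _ _) (aeeq_sym (op_lin hT c1 (hm 1%N) hJ))) _.
      apply: aeeq_trans (aeeq_sym (op_lin hT c0 (hm 0%N) h1)) _.
      apply: (op_ae hT); [exact: L1D (L1Z c0 (hm 0%N)) h1|exact: Lu|].
      apply: aeeq_trans _ (aeeq_sym hr); apply: aeeq_eq => x _.
      by rewrite /monomial expr0 expr1 mulr1 addrA.
    by apply: aeeq_eq => x _; rewrite !mulr0 !add0r.
  exact: (solution_sobolev hab ha hb hs).
split=> //; split.
- split; [by case: hT|by []|].
  move=> u hu; have [h1 h2] := Tmain u hu.
  have [hw _] := sobolev_taylor hab ha hb hu.
  by case: (hu) => Lu _; split; [exact: Lu|exact: hw|exact: h1|exact: h2].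
- move=> p; have [c0 [c1 [w [hw hr]]]] := cpoly_taylor hab ha hb (fun k => p`_k) (size p).
  have := taylor_sobolev hab ha hb (L1_cpoly _ _ _ _) hw hr.
  congr (sobolev _ _ _ _); apply/funext => x.
  by rewrite cpolyE horner_coef.
- split.
    split; [| |move=> [|[|k]]//  _].
    + by have [c0 [c1 hs]] := phi0 0%N isT; exact: (weak_of_solution hab ha hb hs).
    + by have [c0 [c1 hs]] := phi0 1%N isT; exact: (weak_of_solution hab ha hb hs).
    + exact: (weak_of_solution hab ha hb (phi2 k)).
  move=> k k2; case: hphi => _ /(_ k k2)[v [v1 [[e C1 C2] v0 v10]]].
  exists v, v1; split; [|exact: v0|exact: v10].
  by split; [exact: aeeq_trans (hTphi k) e|exact: C1|exact: C2].
Qed.
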